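(* Let $f=\frac1n\sum_{i=1}^n f_i:\mathbb{R}^d\to\mathbb{R}$ satisfy the assumptions listed in the context ($L$-smooth, convex $f_i$; $\mu$-strongly convex $f$), let $w^*$ be its unique minimizer, $\kappa=L/\mu$, and $\sigma^2=\frac1n\sum_{i=1}^n\big(f(w^* )-f_i^*\big)$. Let $\tau\ge 1$ and let $T>\tau$ be an integer. Set $\upsilon=\frac{1}{4L}$, $\gamma=\left(\frac{\tau}{T}\right)^{1/T}$, $\gamma_k=\gamma^{k+1}$, $\eta_k=\upsilon\,\gamma_k$, $\eta=\eta_0$, and $$\lambda_k:=\frac{1-2\eta L}{\eta_k\mu}\left(1-(1-\eta_k\mu)^k\right).$$ Consider stochastic heavy ball (in averaging form, with batch-size $b\in\{1,\dots,n\}$) $$w_{k+1}=\frac{\lambda_{k+1}}{\lambda_{k+1}+1}\,w_k+\frac{1}{\lambda_{k+1}+1}\,z_k,\qquad z_k=z_{k-1}-\eta_k\nabla f_{ik}(w_k),\qquad z_0=w_0 .$$ Then $$\mathbb{E}\|w_{T-1}-w^*\|^2\le C_4\,\|w_0-w^*\|^2\exp\left(-\frac{T}{\kappa}\,\frac{\gamma}{4\ln(T/\tau)}\right)+C_4\,C_5\,\frac{\sigma^2}{T},$$ where $C_4=C_4(\kappa,T)$ and $C_5=C_5(\kappa,T)$ are quantities that are polynomial in $\kappa$ and poly-logarithmic in $T$ (they may also depend on $L$, on $\tau$, and on $\zeta=\sqrt{\frac{n-b}{(n-1)b}}$, but not on $w_0$, $\sigma$ or otherwise on $f$).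
   Context: Setting: $f(w)=\frac1n\sum_{i=1}^n f_i(w)$ on $\mathbb{R}^d$. Each $f_i$ is differentiable, convex, $L$-smooth and bounded below with minimum value $f_i^*$ (so $f$ is $L$-smooth); $f$ is $\mu$-strongly convex, $\mu>0$. At each iteration $k$ a mini-batch $B_k\subseteq\{1,\dots,n\}$ of size $b$ is sampled uniformly without replacement, independently across iterations, and $\nabla f_{ik}(w):=\frac1b\sum_{i\in B_k}\nabla f_i(w)$. The recursion for $z_k$ is used for $k\ge1$, starting from $z_0=w_0$; the recursion for $w_{k+1}$ is used for $k\ge 0$. $\mathbb{E}$ is over all mini-batches; $\|\cdot\|$ is the Euclidean norm. *)

(* Defs.v *)
From HB Require Import structures.
From mathcomp Require Import all_boot all_order all_algebra.
From mathcomp Require Import all_classical all_reals all_analysis.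

Set Implicit Arguments.
Unset Strict Implicit.
Unset Printing Implicit Defensive.

Import Order.TTheory GRing.Theory Num.Theory.
Import numFieldNormedType.Exports.

Local Open Scope classical_set_scope.
Local Open Scope ring_scope.

Section functions.
Context {R : realType} {d : nat}.
Implicit Types (f : 'rV[R]_d -> R) (x y : 'rV[R]_d).

(* [`|x|] on ['rV[R]_d] is the sup norm, hence a separate Euclidean norm. *)
Definition enorm x : R := Num.sqrt (\sum_j x 0 j ^+ 2).

Definition grad f x : 'rV[R]_d := \row_j 'D_(delta_mx 0 j) f x.

Definition smooth (L : R) f : Prop :=
  (forall x, differentiable f x) /\
  (forall x y, enorm (grad f x - grad f y) <= L * enorm (x - y)).

Definition convex f : Prop := @convex_function R 'rV[R]_d setT f.

Definition strongly_convex (mu : R) f : Prop :=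
  forall (t : R) x y, 0 <= t <= 1 ->
    f (t *: x + (1 - t) *: y) <=
      t * f x + (1 - t) * f y - mu / 2 * (t * (1 - t)) * enorm (x - y) ^+ 2.

End functions.

Section finite_sum.
Context {R : realType} {d n : nat}.
Variable f : 'I_n -> 'rV[R]_d -> R.

Definition favg (x : 'rV[R]_d) : R := n%:R^-1 * \sum_i f i x.

(* The infimum need not be attained (e.g. logistic losses). *)
Definition fmin (i : 'I_n) : R := inf (range (f i)).

Definition sigma2 (x : 'rV[R]_d) : R := n%:R^-1 * \sum_i (favg x - fmin i).

Definition batch_grad (b : nat) (B : {set 'I_n}) (x : 'rV[R]_d) : 'rV[R]_d :=
  b%:R^-1 *: \sum_(i in B) grad (f i) x.

End finite_sum.

(* Independence is the product rule over every finite subfamily.  Since [A]   *)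
(* is finite, measurability of each [X k] is that of its point preimages.     *)
Section sampling.
Context {R : realType} {disp : measure_display} {Omega : measurableType disp}.
Variable P : probability Omega R.

Definition independent_family (A : finType) (X : nat -> Omega -> A) : Prop :=
  forall (J : seq nat) (E : nat -> set A), uniq J ->
    P (\bigcap_(k in [set` J]) (X k @^-1` E k)) =
    (\prod_(k <- J) P (X k @^-1` E k))%E.

Definition iid_uniform_batches (n b : nat) (X : nat -> Omega -> {set 'I_n})
    : Prop :=
  [/\ forall k S, measurable (X k @^-1` [set S]),
      forall k S, P (X k @^-1` [set S]) =
                  (if #|S| == b then 'C(n, b)%:R^-1 else 0)%:E
    & independent_family X].

End sampling.

Section parameters.
Context {R : realType}.

(* With [x / 0 = 0], the case [n = 1] (which forces [b = 1]) gives 0.         *)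
Definition zeta (n b : nat) : R :=
  Num.sqrt ((n%:R - b%:R) / ((n%:R - 1) * b%:R)).

Definition gam (tau : R) (T : nat) : R := (tau / T%:R) `^ (T%:R^-1).

Definition step (L tau : R) (T k : nat) : R :=
  (4 * L)^-1 * gam tau T ^+ k.+1.

Definition lam (L mu tau : R) (T k : nat) : R :=
  (1 - 2 * step L tau T 0 * L) / (step L tau T k * mu) *
  (1 - (1 - step L tau T k * mu) ^+ k).

(* [C L tau zeta kappa T] is polynomial in [kappa] and poly-logarithmic in    *)
(* [T]: it is bounded by [K * kappa ^ p * (ln T) ^ q], with degrees that are  *)
(* absolute and a coefficient depending only on [L], [tau] and [zeta].  The   *)
(* ranges are those in which [kappa = L / mu] and [T > tau >= 1] can lie.     *)
Definition poly_polylog (C : R -> R -> R -> R -> nat -> R) : Prop :=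
  exists p q : nat, forall L tau zeta : R, exists K : R,
    forall (kappa : R) (T : nat), 1 <= kappa -> (1 < T)%N -> tau < T%:R ->
      0 <= C L tau zeta kappa T <= K * kappa ^+ p * ln T%:R ^+ q.

End parameters.

(* Main.v *)
Require Import Defs.
From HB Require Import structures.
From mathcomp Require Import all_boot all_order all_algebra.
From mathcomp Require Import all_classical all_reals all_analysis.
From mathcomp Require Import measurable_realfun.
From mathcomp Require Import ring lra.

(* With [x = w - wstar], [y = z - wstar], [e_k = eta_k mu],                   *)
(* [theta_k = e_k lam_k] and [phi = 2 (f w - f wstar) / mu >= |x|^2], the     *)
(* usual energy [V_k = |y|^2 + (theta_k + e_k (1 - L eta_k)) phi] is          *)
(* nonincreasing in expectation up to the noise [22 L eta_k^2 sigma^2], but   *)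
(* it does not contract at rate [e_k].  The energy                            *)
(*   [E_k = |y - 3/10 x|^2 - 1/5 |x|^2 + (theta_k + 7/10 e_k) phi]            *)
(* does, by the factor [1 - e_k], as long as [theta_k] is close to [1/2]:     *)
(* this is a quadratic form in [x] and [w_k - w_(k-1)], and it is essential   *)
(* to bound the variance of the gradients by their cocoercivity               *)
(* [<grad f(w), x> >= f w - f wstar + A / (2 L)], with [A] the mean of        *)
(* [|grad f_i(w) - grad f_i(wstar)|^2], because [A <= 2 L (f w - f wstar)]    *)
(* alone would use up the whole margin.  Now [theta_k] is close to [1/2] as   *)
(* soon as [k >= 160 kappa] and [e_k >= 40 (1 - gam)].  The sum of [e_k] over *)
(* all other [k] is bounded by an absolute constant, so using [V] there costs *)
(* a constant factor only; [E] and [V] are equivalent where both are used.    *)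
(* Unrolling, with [x^2 exp (- x) <= 2] to sum the noise, gives the bound.    *)

Set Implicit Arguments.
Unset Strict Implicit.
Unset Printing Implicit Defensive.

Import Order.TTheory GRing.Theory Num.Theory.
Import numFieldNormedType.Exports.

Local Open Scope classical_set_scope.
Local Open Scope ring_scope.

(** * Euclidean inner product and gradients *)

Section inner_product.
Context {R : realType} {d : nat}.
Implicit Types (x y z : 'rV[R]_d) (a : R).

(** In averaged form the momentum is a relation [z - w = lam (w - w')] between the new iterate [w],
    the previous one [w'] and the current [z]. Pairing the mean gradient with [z - wstar] therefore
    gives progress towards [wstar] and exchanges [lam * fgap w'] for [lam * fgap w]. An energy
    inequality follows once the second moment of the mini-batch gradient is controlled, up to
    [sigma2], by [fgap] ([mono_energy_step]) or by cocoercivity ([contr_energy_step]); [settled]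
    marks the iterations at which the latter applies.

    The schedule enters through four facts. The rates of the unsettled iterations add up to at most
    80 ([unsettled_mass]), so patching the two energies costs a constant and leaves the contraction
    [expR (- phase)] ([energy_bound]). Since [gam ^+ T = tau / T] and [1 - gam <= l / T] with
    [l = ln (T / tau)], the geometric sum [phase] is about [gam T / (4 kappa l)] or more
    ([phase_horizon_ge]). The same sum bounds each step by a multiple of the contraction still to
    come, plus a [tau / T] term, so each noise term is of order [(kappa^2 l^2 + tau^2) / T^2]
    ([noise_term_le]). At the end the energy controls the squared distance up to a factor of order
    [kappa] ([final_damping_ge]).

    All this happens on finite sequences of batches, under [iterated_mean]; [expectation_history]
    transfers it to the probability space. *)

Definition dot x y : R := \sum_j x 0 j * y 0 j.

Lemma dotC x y : dot x y = dot y x.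
Proof. by apply: eq_bigr => j _; rewrite mulrC. Qed.

Lemma dotDl x y z : dot (x + y) z = dot x z + dot y z.
Proof. by rewrite /dot -big_split /=; apply: eq_bigr => j _; rewrite mxE mulrDl. Qed.

Lemma dotZl a x y : dot (a *: x) y = a * dot x y.
Proof. by rewrite /dot mulr_sumr; apply: eq_bigr => j _; rewrite mxE mulrA. Qed.

Lemma dotNl x y : dot (- x) y = - dot x y.
Proof. by rewrite -scaleN1r dotZl mulN1r. Qed.

Lemma dotBl x y z : dot (x - y) z = dot x z - dot y z.
Proof. by rewrite dotDl dotNl. Qed.

Lemma dotDr x y z : dot z (x + y) = dot z x + dot z y.
Proof. by rewrite !(dotC z) dotDl. Qed.

Lemma dotZr a x y : dot x (a *: y) = a * dot x y.
Proof. by rewrite !(dotC x) dotZl. Qed.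

Lemma dotNr x y : dot x (- y) = - dot x y.
Proof. by rewrite !(dotC x) dotNl. Qed.

Lemma dotBr x y z : dot z (x - y) = dot z x - dot z y.
Proof. by rewrite !(dotC z) dotBl. Qed.

Lemma dot_suml (I : finType) (P : pred I) (F : I -> 'rV[R]_d) y :
  dot (\sum_(i | P i) F i) y = \sum_(i | P i) dot (F i) y.
Proof.
rewrite /dot exchange_big /=; apply: eq_bigr => j _.
by rewrite summxE mulr_suml.
Qed.

Lemma dotxx_ge0 x : 0 <= dot x x.
Proof. by apply: sumr_ge0 => j _; rewrite -expr2 sqr_ge0. Qed.

Lemma enorm_ge0 x : 0 <= enorm x.
Proof. exact: sqrtr_ge0. Qed.

Lemma enorm_sqr x : enorm x ^+ 2 = dot x x.
Proof.
rewrite /enorm sqr_sqrtr; first by apply: eq_bigr => j _; rewrite expr2.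
by apply: sumr_ge0 => j _; exact: sqr_ge0.
Qed.

Lemma enormZ a x : enorm (a *: x) = `|a| * enorm x.
Proof.
apply/eqP; rewrite -(@eqrXn2 _ 2) ?mulr_ge0 ?enorm_ge0 //.
by rewrite exprMn !enorm_sqr dotZl dotZr mulrA -expr2 real_normK ?num_real.
Qed.

Lemma enormN x : enorm (- x) = enorm x.
Proof. by rewrite -scaleN1r enormZ normrN1 mul1r. Qed.

Lemma dot_le_enorm x y : dot x y <= enorm x * enorm y.
Proof.
have xx := dotxx_ge0 x; have yy := dotxx_ge0 y.
have discr : dot x y ^+ 2 <= dot x x * dot y y.
  have [y0|y0] := eqVneq (dot y y) 0.
    have [->|s0] := eqVneq (dot x y) 0; first by rewrite y0 expr0n mulr0.
    have := dotxx_ge0 (x - ((dot x x + 1) / dot x y) *: y).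
    rewrite !(dotDl, dotDr, dotNl, dotNr, dotZl, dotZr) (dotC y x) y0 divfK //.
    lra.
  have := dotxx_ge0 (dot y y *: x - dot x y *: y).
  rewrite !(dotDl, dotDr, dotNl, dotNr, dotZl, dotZr) (dotC y x) => p.
  rewrite -subr_ge0 -(pmulr_rge0 _ (x := dot y y)) ?lt0r ?y0 //; lra.
apply: le_trans (ler_norm _) _.
rewrite -(@ler_pXn2r _ 2) ?nnegrE ?mulr_ge0 ?enorm_ge0 //.
by rewrite real_normK ?num_real // exprMn !enorm_sqr.
Qed.

End inner_product.

(** * Directional derivatives and a mean value theorem along lines *)

Section smooth_functions.
Context {R : realType} {d : nat}.
Implicit Types (f : 'rV[R]_d -> R) (x y v : 'rV[R]_d).

Lemma derive_grad f x v : differentiable f x -> 'D_v f x = dot (grad f x) v.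
Proof.
move=> df; rewrite deriveE //.
have -> : v = \sum_j v 0 j *: delta_mx 0 j :> 'rV[R]_d by exact: row_sum_delta.
rewrite linear_sum /=; rewrite /dot.
apply: eq_bigr => j _; rewrite linearZ /= mxE deriveE //.
rewrite mulrC; congr (_ * _).
by rewrite summxE (bigD1 j) //= big1 ?addr0 ?mxE ?eqxx ?mulr1 // => i ij;
  rewrite !mxE eqxx /= eq_sym (negbTE ij) mulr0.
Qed.

Lemma is_derive_line f x v (t : R) : differentiable f (x + t *: v) ->
  is_derive t 1 (fun s : R => f (x + s *: v)) (dot (grad f (x + t *: v)) v).
Proof.
move=> df.
have dl : differentiable (fun s : R => x + s *: v) t by [].
have dfl : differentiable (fun s : R => f (x + s *: v)) t.
  exact: (differentiable_comp dl).
have E : 'D_1 (fun s : R => f (x + s *: v)) t = dot (grad f (x + t *: v)) v.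
  rewrite -derive_grad // /derive.
  set g1 := (fun h => h^-1 *: _); set g2 := (fun h => h^-1 *: _).
  suff -> : g1 = g2 by [].
  apply/funext => h; rewrite /g1 /g2 /=.
  by rewrite [h%:A]mulr1 scalerDl addrCA.
exact: DeriveDef (diff_derivable dfl) E.
Qed.

(** The mean value theorem applied to [f (x + s v) - a s^2]. The quadratic correction with
    [a = L / 2 * dot v v] gives the sharp constant of the descent lemma without integration. *)
Lemma line_mvt f x v (a : R) : (forall y, differentiable f y) ->
  exists2 c : R, 0 <= c <= 1 &
    f (x + v) - f x - a = dot (grad f (x + c *: v)) v - 2 * a * c.
Proof.
move=> df.
pose g (s : R) := f (x + s *: v) - a * s ^+ 2.
have dg (s : R) : is_derive s 1 g (dot (grad f (x + s *: v)) v - 2 * a * s).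
  have -> : g = (fun s : R => f (x + s *: v)) - (fun s => a *: (id ^+ 2) s).
    by [].
  have D := is_derive_line (df (x + s *: v)).
  apply: is_derive_eq.
  by rewrite /GRing.scale /= expr1; ring.
have [c cab] := @MVT R g _ 0 1 ltr01 (fun s _ => dg s)
  (continuous_subspaceT (fun s => differentiable_continuous
     (iffLR (derivable1_diffP _ _) (ex_derive (is_derive := dg s))))).
rewrite /g scale1r scale0r addr0 expr1n expr0n /= !(mulr1, mulr0, subr0) => E.
exists c; first by move: cab; rewrite in_itv /= => /andP[/ltW -> /ltW ->].
by rewrite -E; ring.
Qed.

End smooth_functions.

(** * First-order inequalities for smooth convex functions *)

Section smooth_convex_functions.
Context {R : realType} {d : nat}.
Implicit Types (f : 'rV[R]_d -> R) (x y v : 'rV[R]_d).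

(** Stands for the limit [t -> 0] when a convexity inequality on a segment is divided by [t]. *)
Lemma ler_addtM (a b c : R) :
  (forall t : R, 0 < t <= 1 -> a <= b + t * c) -> a <= b.
Proof.
move=> H; apply/ler_addgt0Pr => e e0.
have c1 : 0 < `|c| + 1 by have := normr_ge0 c; lra.
pose t := Num.min 1 (e / (`|c| + 1)).
have t0 : 0 < t by rewrite lt_min ltr01 divr_gt0.
have t1 : t <= 1 by rewrite ge_min lexx.
apply: le_trans (H t _) _; first by rewrite t0 t1.
rewrite lerD2l.
have te : t * (`|c| + 1) <= e by rewrite -ler_pdivlMr // ge_min lexx orbT.
have := ler_norm c; have := normr_ge0 c; nra.
Qed.

Lemma convex_strongly_convex0 f : convex f -> strongly_convex 0 f.
Proof.
move=> cf t x y t01.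
have := cf (Itv01 (proj1 (andP t01)) (proj2 (andP t01))) x y.
rewrite !inE => /(_ I I).
by rewrite mul0r !mul0r subr0.
Qed.

Lemma smooth_upper_bound L f x v : smooth L f ->
  f (x + v) <= f x + dot (grad f x) v + L / 2 * dot v v.
Proof.
move=> [df gL].
have [c /andP[c0 _] E] := line_mvt x v (L / 2 * dot v v) df.
have : dot (grad f (x + c *: v) - grad f x) v <= L * c * dot v v.
  apply: le_trans (dot_le_enorm _ _) _.
  have := gL (x + c *: v) x; rewrite addrAC subrr add0r enormZ (ger0_norm c0).
  rewrite -enorm_sqr expr2 => h.
  apply: le_trans (ler_wpM2r (enorm_ge0 v) h) _.
  by rewrite !mulrA.
rewrite dotBl; lra.
Qed.

Lemma convex_grad_le L f x v : convex f -> smooth L f ->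
  f x + dot (grad f x) v <= f (x + v).
Proof.
move=> /convex_strongly_convex0 cf [df gL].
apply: (@ler_addtM _ _ (L * dot v v)) => t /andP[t0 t1].
have [c /andP[c0 c1] E] := line_mvt x (t *: v) 0 df.
have t01 : 0 <= t <= 1 by rewrite ltW.
have := cf t (x + v) x t01.
have -> : t *: (x + v) + (1 - t) *: x = x + t *: v.
  by rewrite scalerDr scalerBl scale1r (addrC (t *: x)) -addrA (addrC (t *: x)) subrK addrC.
rewrite !mul0r subr0 => ub.
have h : dot (grad f x - grad f (x + c *: (t *: v))) v <= L * t * dot v v.
  apply: le_trans (dot_le_enorm _ _) _.
  have := gL (x + c *: (t *: v)) x.
  rewrite addrAC subrr add0r !enormZ -enormN opprB.
  rewrite (ger0_norm c0) (gtr0_norm t0) -enorm_sqr => g.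
  have v0 := enorm_ge0 v.
  have L0 : 0 <= L * (c * (t * enorm v)) by apply: le_trans g; exact: enorm_ge0.
  have := ler_wpM2r v0 g.
  (* [smooth] does not state [0 <= L]; a nonzero direction forces it through the Lipschitz bound. *)
  have [v1|v1] := eqVneq (enorm v) 0; first by rewrite v1; nra.
  have L1 : 0 <= L.
    have := gL (x + v) x; rewrite addrAC subrr add0r => g'.
    have := le_trans (enorm_ge0 _) g'; rewrite pmulr_lge0 // lt0r v1; exact: v0.
  have cL : c * (L * t * enorm v ^+ 2) <= 1 * (L * t * enorm v ^+ 2).
    by apply: ler_wpM2r => //; rewrite !mulr_ge0 ?sqr_ge0 // ltW.
  lra.
move: E; rewrite mulr0 mul0r !subr0 dotZr => E.
rewrite dotBl in h.
have : t * (dot (grad f x) v) <= t * (f (x + v) - f x + t * (L * dot v v)).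
  apply: (@le_trans _ _ (t * (dot (grad f (x + c *: (t *: v))) v + t * (L * dot v v)))).
    by apply: ler_wpM2l; [exact: ltW|lra].
  rewrite mulrDr -E mulrDr; lra.
rewrite ler_pM2l //; lra.
Qed.

(** Both bounds are taken at the point [y + g / L]: the convex lower bound expanded at [x], the
    smooth upper bound at [y]. The linear terms differ by [|g|^2 / L], of which the quadratic term
    takes half. *)
Lemma cocoercive L f x y : 0 < L -> convex f -> smooth L f ->
  f x + dot (grad f x) (y - x) +
    dot (grad f x - grad f y) (grad f x - grad f y) / (2 * L) <= f y.
Proof.
move=> L0 cf sf; set g := grad f x - grad f y.
have lb := convex_grad_le x (y - x + L^-1 *: g) cf sf.
have ub := smooth_upper_bound y (L^-1 *: g) sf.
rewrite addrA (addrC x) subrK in lb.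
have := le_trans lb ub.
rewrite dotDr !dotZr !dotZl.
have -> : L / 2 * (L^-1 * (L^-1 * dot g g)) = dot g g / (2 * L) by field; lra.
have e : L^-1 * dot (grad f x) g - L^-1 * dot (grad f y) g = 2 * (dot g g / (2 * L)).
  by rewrite -mulrBr -dotBl -/g; field; lra.
lra.
Qed.

(** A gradient step of length [1 / L] lowers [f] by at least [|grad f|^2 / (2 L)] and cannot pass
    below the infimum. *)
Lemma grad_sqr_le L f x : 0 < L -> smooth L f -> has_lbound (range f) ->
  dot (grad f x) (grad f x) <= 2 * L * (f x - inf (range f)).
Proof.
move=> L0 sf bf.
have ub := smooth_upper_bound x (- L^-1 *: grad f x) sf.
have lb : inf (range f) <= f (x + - L^-1 *: grad f x).
  by apply: ge_inf => //; exists (x + - L^-1 *: grad f x).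
have := le_trans lb ub; rewrite !dotZr !dotZl.
set g := dot _ _.
have -> : L / 2 * (- L^-1 * (- L^-1 * g)) = g / (2 * L) by field; lra.
have -> : - L^-1 * g = - 2 * (g / (2 * L)) by field; lra.
have -> : g = 2 * L * (g / (2 * L)) by field; lra.
have e : 2 * L * (g / (2 * L)) / (2 * L) = g / (2 * L) by field; lra.
rewrite e => h.
by apply: ler_wpM2l; lra.
Qed.

End smooth_convex_functions.

(** * Mini-batches and one-step energy inequalities *)

Section batches.
Context {R : realType} {d n : nat}.
Variable b : nat.
Hypothesis b1n : (1 <= b <= n)%N.

Let b_gt0 : (0 < b)%N. Proof. by case/andP: b1n. Qed.
Let b_le_n : (b <= n)%N. Proof. by case/andP: b1n. Qed.
Let n_gt0 : (0 < n)%N. Proof. exact: leq_trans b_gt0 b_le_n. Qed.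
Let binnb : 'C(n, b)%:R != 0 :> R.
Proof. by rewrite pnatr_eq0 -lt0n bin_gt0. Qed.

Definition batch_prob (S : {set 'I_n}) : R :=
  if #|S| == b then 'C(n, b)%:R^-1 else 0.

Lemma batch_prob_ge0 S : 0 <= batch_prob S.
Proof. by rewrite /batch_prob; case: ifP => // _; rewrite invr_ge0. Qed.

Lemma sum_batch_prob : \sum_S batch_prob S = 1.
Proof.
rewrite -big_mkcond /= sumr_const.
have -> : #|(fun S : {set 'I_n} => #|S| == b)| = 'C(n, b).
  by rewrite -[in RHS](card_ord n) -card_draws; apply: eq_card => S; rewrite !inE.
by rewrite -[LHS]mulr_natr mulVf.
Qed.

Lemma card_batches_containing (i : 'I_n) :
  #|[set S : {set 'I_n} | (#|S| == b) && (i \in S)]%SET| = 'C(n.-1, b.-1).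
Proof.
have -> : 'C(n.-1, b.-1) =
    #|[set S : {set 'I_n} | (S \subset ~: [set i]) & (#|S| == b.-1)]%SET|.
  by rewrite cards_draws cardsC1 card_ord.
rewrite -(card_in_imset (f := fun S : {set 'I_n} => S :\ i)); last first.
  move=> S S'; rewrite !inE => /andP[_ iS] /andP[_ iS'] E.
  by rewrite -(finset.setD1K iS) -(finset.setD1K iS') E.
congr #|pred_of_set _|; apply/setP => S; apply/imsetP/idP.
  move=> [S']; rewrite inE => /andP[/eqP Sb iS] ->.
  rewrite inE finset.subsetC finset.sub1set !inE eqxx /=.
  by rewrite -Sb (cardsD1 i S') iS.
rewrite inE finset.subsetC finset.sub1set inE => /andP[iS /eqP Sb].
exists (i |: S); last by rewrite finset.setU1K.
by rewrite inE cardsU1 iS Sb add1n prednK // eqxx finset.setU11.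
Qed.

(** Double counting: each index lies in ['C(n.-1, b.-1)] batches, and
    [b * 'C(n, b) = n * 'C(n.-1, b.-1)]. *)
Lemma batch_mean (a : 'I_n -> R) :
  \sum_S batch_prob S * (b%:R^-1 * \sum_(i in S) a i) = n%:R^-1 * \sum_i a i.
Proof.
transitivity (\sum_i \sum_(S : {set 'I_n} | (#|S| == b) && (i \in S))
    'C(n, b)%:R^-1 * (b%:R^-1 * a i)).
  rewrite (exchange_big_dep predT) //=; apply: eq_bigr => S _.
  rewrite /batch_prob; case: ifP => _; last by rewrite mul0r big_pred0.
  by rewrite !mulr_sumr.
rewrite mulr_sumr; apply: eq_bigr => i _.
rewrite sumr_const.
have -> : #|(fun S : {set 'I_n} => (#|S| == b) && (i \in S))| = 'C(n.-1, b.-1).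
  by rewrite -(card_batches_containing i); apply: eq_card => S; rewrite !inE.
have b0 : b%:R != 0 :> R by rewrite pnatr_eq0 -lt0n.
have n0 : n%:R != 0 :> R by rewrite pnatr_eq0 -lt0n.
have E : b%:R * 'C(n, b)%:R = n%:R * 'C(n.-1, b.-1)%:R :> R.
  by rewrite -!natrM -[in RHS](prednK n_gt0) mul_bin_diag !prednK.
rewrite -[LHS]mulr_natr.
have -> : 'C(n.-1, b.-1)%:R = n%:R^-1 * (b%:R * 'C(n, b)%:R) :> R.
  by rewrite E mulKf.
by field; rewrite b0 n0.
Qed.

(** Jensen's inequality, from the mean squared deviation about the batch mean being nonnegative. *)
Lemma batch_grad_sqr_le (f : 'I_n -> 'rV[R]_d -> R) (S : {set 'I_n}) x :
  #|S| = b -> dot (batch_grad f b S x) (batch_grad f b S x) <=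
  b%:R^-1 * \sum_(i in S) dot (grad (f i) x) (grad (f i) x).
Proof.
move=> Sb; set m := batch_grad f b S x.
have b0 : 0 < b%:R :> R by rewrite ltr0n.
have mE : b%:R^-1 * \sum_(i in S) dot (grad (f i) x) m = dot m m.
  by rewrite -dot_suml -dotZl.
have : 0 <= b%:R^-1 * \sum_(i in S) dot (grad (f i) x - m) (grad (f i) x - m).
  by rewrite mulr_ge0 ?invr_ge0 ?ler0n // sumr_ge0 // => i _; exact: dotxx_ge0.
have -> : \sum_(i in S) dot (grad (f i) x - m) (grad (f i) x - m) =
    \sum_(i in S) dot (grad (f i) x) (grad (f i) x) +
    \sum_(i in S) (dot m m) - 2 * \sum_(i in S) dot (grad (f i) x) m.
  rewrite mulr_sumr -big_split -sumrB; apply: eq_bigr => i _ /=.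
  by rewrite !(dotBl, dotBr) (dotC m); ring.
rewrite sumr_const Sb -[dot m m *+ b]mulr_natl mulrBr mulrDr (mulrCA _ 2) mE mulKf ?gt_eqF //.
lra.
Qed.

End batches.

(** * One-step inequalities for the averaged objective *)

Section finite_sums.
Context {R : realType} {d n b : nat}.
Variables (f : 'I_n -> 'rV[R]_d -> R) (L mu : R) (wstar : 'rV[R]_d).
Hypothesis d_gt0 : (0 < d)%N.
Hypothesis b1n : (1 <= b <= n)%N.
Hypothesis L_gt0 : 0 < L.
Hypothesis mu_gt0 : 0 < mu.
Hypothesis cf : forall i, convex (f i).
Hypothesis sf : forall i, smooth L (f i).
Hypothesis bf : forall i, has_lbound (range (f i)).
Hypothesis scf : strongly_convex mu (favg f).
Hypothesis wmin : forall x, favg f wstar <= favg f x.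
Implicit Types (x y v w z : 'rV[R]_d).

Let n_gt0 : 0 < n%:R :> R.
Proof. by rewrite ltr0n; case/andP: b1n => b0 /(leq_trans b0). Qed.

Definition fgap x : R := favg f x - favg f wstar.

Definition mean_grad x : 'rV[R]_d := n%:R^-1 *: \sum_i grad (f i) x.

Definition mean_sqr (g : 'I_n -> 'rV[R]_d) : R := n%:R^-1 * \sum_i dot (g i) (g i).

Definition grad_diff x : R := mean_sqr (fun i => grad (f i) x - grad (f i) wstar).

Let meanD (a c : 'I_n -> R) :
  n%:R^-1 * (\sum_i (a i + c i)) = n%:R^-1 * \sum_i a i + n%:R^-1 * \sum_i c i.
Proof. by rewrite big_split mulrDr. Qed.

Let mean_cst (c : R) : n%:R^-1 * (\sum_(i < n) c) = c.
Proof. by rewrite sumr_const card_ord -[c *+ n]mulr_natl mulKf ?gt_eqF. Qed.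

Let mean_le (a c : 'I_n -> R) : (forall i, a i <= c i) ->
  n%:R^-1 * (\sum_i a i) <= n%:R^-1 * \sum_i c i.
Proof.
by move=> h; rewrite ler_pM2l ?invr_gt0 //; apply: ler_sum => i _; exact: h.
Qed.

Let dot_mean_grad x v : n%:R^-1 * \sum_i dot (grad (f i) x) v = dot (mean_grad x) v.
Proof. by rewrite -dot_suml -dotZl. Qed.

Lemma mean_sqr_ge0 g : 0 <= mean_sqr g.
Proof.
by rewrite mulr_ge0 ?invr_ge0 ?ler0n // sumr_ge0 // => i _; exact: dotxx_ge0.
Qed.

Lemma favg_upper_bound x v :
  favg f (x + v) <= favg f x + dot (mean_grad x) v + L / 2 * dot v v.
Proof.
have := mean_le (fun i => smooth_upper_bound x v (sf i)).
by rewrite !meanD mean_cst dot_mean_grad.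
Qed.

Lemma favg_grad_le x v : favg f x + dot (mean_grad x) v <= favg f (x + v).
Proof.
have := mean_le (fun i => convex_grad_le x v (cf i) (sf i)).
by rewrite meanD dot_mean_grad.
Qed.

Lemma favg_strong_grad_le x v :
  favg f x + dot (mean_grad x) v + mu / 2 * dot v v <= favg f (x + v).
Proof.
apply: (@ler_addtM _ _ _ (mu / 2 * dot v v)) => t /andP[t0 t1].
have t01 : 0 <= t <= 1 by rewrite ltW.
have := scf (x + v) x t01.
have -> : t *: (x + v) + (1 - t) *: x = x + t *: v.
  by rewrite scalerDr scalerBl scale1r (addrC (t *: x)) -addrA (addrC (t *: x)) subrK addrC.
rewrite [x + v - x]addrAC subrr add0r enorm_sqr => ub.
have := le_trans (favg_grad_le x (t *: v)) ub; rewrite dotZr => h.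
rewrite -(ler_pM2l t0); lra.
Qed.

(** Minimality is tested at [wstar - mean_grad wstar / L], so the averaged upper bound suffices and
    [favg] itself is never differentiated. *)
Lemma mean_grad_wstar : dot (mean_grad wstar) (mean_grad wstar) = 0.
Proof.
apply/eqP; rewrite eq_le dotxx_ge0 andbT.
have := le_trans (wmin _) (favg_upper_bound wstar (- L^-1 *: mean_grad wstar)).
move: (mean_grad wstar) => m; rewrite !dotZr !dotZl; set g := dot _ _.
have -> : L / 2 * (- L^-1 * (- L^-1 * g)) = L^-1 * g / 2 by field; rewrite gt_eqF.
move=> h; have h' : L^-1 * g <= 0 by lra.
by move: h'; rewrite pmulr_rle0 // invr_gt0.
Qed.

Lemma dot_mean_grad_wstar v : dot (mean_grad wstar) v = 0.
Proof.
have e0 : enorm (mean_grad wstar) = 0.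
  by apply/eqP; rewrite -sqrf_eq0 enorm_sqr mean_grad_wstar.
apply/eqP; rewrite eq_le -{2}(opprK v) dotNr oppr_ge0.
by rewrite !(le_trans (dot_le_enorm _ _)) // e0 mul0r.
Qed.

Lemma fgap_ge0 x : 0 <= fgap x.
Proof. by rewrite subr_ge0. Qed.

Lemma fgap_ge x : mu / 2 * dot (x - wstar) (x - wstar) <= fgap x.
Proof.
have := favg_strong_grad_le wstar (x - wstar).
by rewrite dot_mean_grad_wstar (addrC wstar) subrK /fgap; lra.
Qed.

Lemma fgap_le x : fgap x <= L / 2 * dot (x - wstar) (x - wstar).
Proof.
have := favg_upper_bound wstar (x - wstar).
by rewrite dot_mean_grad_wstar (addrC wstar) subrK /fgap; lra.
Qed.

Lemma mu_le_L : mu <= L.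
Proof.
pose e : 'rV[R]_d := delta_mx 0 (Ordinal d_gt0).
have := le_trans (fgap_ge (wstar + e)) (fgap_le (wstar + e)).
rewrite (addrC wstar) addrK.
have -> : dot e e = 1.
  rewrite /dot (bigD1 (Ordinal d_gt0)) //= big1 ?addr0 ?mxE ?eqxx ?mulr1 //.
  by move=> j jd; rewrite !mxE (negbTE jd) andbF mulr0.
lra.
Qed.

Lemma dot_grad_strong x v :
  fgap x + mu / 2 * dot v v <= dot (mean_grad x) v + fgap (x - v).
Proof. by have := favg_strong_grad_le x (- v); rewrite !dotNr dotNl /fgap; lra. Qed.

Lemma dot_grad_coco x :
  fgap x + grad_diff x / (2 * L) <= dot (mean_grad x) (x - wstar).
Proof.
have := mean_le (fun i => cocoercive x wstar L_gt0 (cf i) (sf i)).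
rewrite !meanD dot_mean_grad -(opprB x) dotNr -mulr_suml mulrA /fgap => h.
rewrite /grad_diff /mean_sqr /favg; lra.
Qed.

Lemma sigma2E : sigma2 f wstar =
  n%:R^-1 * \sum_i f i wstar - n%:R^-1 * \sum_i fmin f i.
Proof. by rewrite /sigma2 meanD mean_cst sumrN mulrN. Qed.

Lemma mean_sqr_grad_le x :
  mean_sqr (fun i => grad (f i) x) <= 2 * L * (fgap x + sigma2 f wstar).
Proof.
have := mean_le (fun i => grad_sqr_le x L_gt0 (sf i) (bf i)).
rewrite -/(mean_sqr _) => h; apply: le_trans h _.
rewrite -mulr_sumr mulrCA ler_pM2l ?mulr_gt0 //.
by rewrite big_split sumrN mulrDr mulrN sigma2E /fgap /favg /fmin; lra.
Qed.

Lemma sigma2_ge0 : 0 <= sigma2 f wstar.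
Proof.
have := le_trans (mean_sqr_ge0 _) (mean_sqr_grad_le wstar).
by rewrite pmulr_rge0 ?mulr_gt0 // /fgap subrr add0r.
Qed.

(** Young's inequality [|g|^2 <= 11/10 |g - h|^2 + 11 |h|^2], where the mean of [|h|^2] is at most
    [2 L sigma2]. The first factor stays near 1 to spare the margin of the contraction. *)
Lemma mean_sqr_grad_le_diff x :
  mean_sqr (fun i => grad (f i) x) <=
  11 / 10 * grad_diff x + 22 * L * sigma2 f wstar.
Proof.
have s := mean_sqr_grad_le wstar; rewrite /fgap subrr add0r in s.
suff : mean_sqr (fun i => grad (f i) x) <=
    11 / 10 * grad_diff x + 11 * mean_sqr (fun i => grad (f i) wstar) by lra.
rewrite /grad_diff /mean_sqr (mulrCA (11 / 10)) (mulrCA 11) [11 / 10 * _]mulr_sumr [11 * \sum_i _]mulr_sumr -meanD.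
apply: mean_le => i; set g := grad (f i) x; set h := grad (f i) wstar.
have := dotxx_ge0 (g - 11 *: h).
rewrite !(dotBl, dotBr, dotZl, dotZr) (dotC h); lra.
Qed.

Lemma batch_step_le (eta : R) x v :
  \sum_S batch_prob b S *
     dot (v - eta *: batch_grad f b S x) (v - eta *: batch_grad f b S x) <=
  dot v v - 2 * eta * dot (mean_grad x) v +
    eta ^+ 2 * mean_sqr (fun i => grad (f i) x).
Proof.
have -> : dot v v - 2 * eta * dot (mean_grad x) v +
    eta ^+ 2 * mean_sqr (fun i => grad (f i) x) =
  \sum_S batch_prob b S * (dot v v
     - 2 * eta * (b%:R^-1 * \sum_(i in S) dot (grad (f i) x) v)
     + eta ^+ 2 * (b%:R^-1 * \sum_(i in S) dot (grad (f i) x) (grad (f i) x))).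
  rewrite /mean_sqr -dot_mean_grad -!(batch_mean (R := R) b1n).
  rewrite -[dot v v in LHS]mul1r -(sum_batch_prob (R := R) b1n).
  rewrite mulr_suml !mulr_sumr -sumrB -big_split /=.
  by apply: eq_bigr => S _; rewrite !(mulrCA _ (batch_prob b S)) -mulrBr -mulrDr.
apply: ler_sum => S _; rewrite /batch_prob; case: ifP => [/eqP Sb|]; last by rewrite !mul0r.
apply: ler_wpM2l; first by rewrite invr_ge0.
rewrite -dot_suml -dotZl.
have := batch_grad_sqr_le (R := R) b1n f x Sb.
rewrite -/(batch_grad f b S x); move: (batch_grad f b S x) => m.
move=> /(ler_wpM2l (sqr_ge0 eta)).
rewrite !(dotBl, dotBr, dotZl, dotZr) (dotC v); lra.
Qed.

Definition mono_energy (c : R) w z : R :=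
  dot (z - wstar) (z - wstar) + 2 / mu * c * fgap w.

Definition contr_energy (c : R) w z : R :=
  dot (z - wstar - 3 / 10 *: (w - wstar)) (z - wstar - 3 / 10 *: (w - wstar))
  - 1 / 5 * dot (w - wstar) (w - wstar) + 2 / mu * c * fgap w.

Let sum_batch_probD (F : {set 'I_n} -> R) (c : R) :
  \sum_S batch_prob b S * (F S + c) = \sum_S batch_prob b S * F S + c.
Proof.
under eq_bigr do rewrite mulrDr.
by rewrite big_split /= -mulr_suml (sum_batch_prob (R := R) b1n) mul1r.
Qed.

Let fgap_wstar : fgap wstar = 0. Proof. exact: subrr. Qed.

Let dot_grad_descent (lam : R) w' w z : 0 <= lam -> z - w = lam *: (w - w') ->
  lam * (fgap w - fgap w' + mu / 2 * dot (w - w') (w - w')) <=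
  dot (mean_grad w) (z - w).
Proof.
move=> lam0 ->; rewrite dotZr; apply: ler_wpM2l => //.
by have := dot_grad_strong w (w - w'); rewrite (subKr w w'); lra.
Qed.

Let dot_grad_center w :
  fgap w + mu / 2 * dot (w - wstar) (w - wstar) <= dot (mean_grad w) (w - wstar).
Proof.
have := dot_grad_strong w (w - wstar).
by rewrite (subKr w wstar) fgap_wstar addr0.
Qed.

Let contr_form_ge (eps vt n1 : R) (X U : 'rV[R]_d) :
  0 < eps <= 1 / 4 -> 19 / 40 <= vt <= 41 / 80 -> n1 <= 11 / 40 ->
  dot (7 / 10 *: X + vt *: U) (7 / 10 *: X + vt *: U)
    - (eps * (7 / 10 - n1) + 1 / 5) * dot X X - vt * (eps ^+ 2 * dot U U) <=
  (1 - eps) * (dot (7 / 10 *: X + (vt + 3 / 10 * eps) *: U)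
                   (7 / 10 *: X + (vt + 3 / 10 * eps) *: U)
               - 1 / 5 * dot (X - eps *: U) (X - eps *: U)).
Proof.
move=> /andP[e0 e1] /andP[v0 v1] hn.
(* Right side minus left side is [eps] times the form with coefficients [27/200], [2 B], [C] in [X]
   and [U], plus [eps (11/40 - n1) |X|^2]. Here [27/200 = 41/100 - 11/40] is what remains of the
   [|X|^2] coefficient for the largest [n1]. *)
pose B := 41 / 100 * (1 - eps) - 7 / 10 * vt.
pose C := (1 - eps) * (3 / 5 * vt - 11 / 100 * eps) - vt ^+ 2 + eps * vt.
have disc : B ^+ 2 <= 27 / 200 * C by rewrite /B /C; nra.
have XX := dotxx_ge0 X; have UU := dotxx_ge0 U.
have sq := dotxx_ge0 (27 / 200 *: X + B *: U).
have form : 0 <= 27 / 200 * dot X X + 2 * B * dot X U + C * dot U U.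
  move: sq; rewrite !(dotDl, dotDr, dotZl, dotZr) (dotC U X) => sq.
  have := ler_wpM2r UU disc; lra.
have nX : 0 <= eps * ((11 / 40 - n1) * dot X X).
  by apply: mulr_ge0; [exact: ltW|apply: mulr_ge0 => //; rewrite subr_ge0].
rewrite -subr_ge0.
have := addr_ge0 (mulr_ge0 (ltW e0) form) nX; congr (0 <= _).
rewrite !(dotDl, dotDr, dotNl, dotNr, dotZl, dotZr) (dotC U X) /B /C.
by field.
Qed.

(** The pairing with [w - wstar] yields [fgap w], of which the second moment consumes a fraction
    [L eta]; the pairing with [z - w] turns [lam * fgap w'] into [lam * fgap w]. The previous energy
    pays for [lam * fgap w'] as its coefficient [c] is at least [eta mu lam]. *)
Lemma mono_energy_step (eta lam c : R) w' w z :
  0 <= eta -> 0 <= lam -> z - w = lam *: (w - w') -> eta * mu * lam <= c ->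
  \sum_S batch_prob b S *
    mono_energy (eta * mu * lam + eta * mu * (1 - L * eta)) w
      (z - eta *: batch_grad f b S w) <=
  mono_energy c w' z + 22 * L * eta ^+ 2 * sigma2 f wstar.
Proof.
move=> eta0 lam0 zw lec; rewrite /mono_energy sum_batch_probD.
under eq_bigr do rewrite (addrAC z).
have st := batch_step_le eta w (z - wstar).
have m2 := ler_wpM2l (sqr_ge0 eta) (mean_sqr_grad_le w).
have dc := dot_grad_center w.
have dd := dot_grad_descent lam0 zw.
have gE : dot (mean_grad w) (z - wstar) =
    dot (mean_grad w) (w - wstar) + dot (mean_grad w) (z - w).
  by rewrite -dotDr; congr dot; rewrite [RHS]addrC addrA subrK.
have F' := fgap_ge0 w'.
have D0 : 0 <= lam * (mu / 2 * dot (w - w') (w - w')).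
  by rewrite !mulr_ge0 ?dotxx_ge0 // ltW.
have W0 : 0 <= mu / 2 * dot (w - wstar) (w - wstar).
  by rewrite !mulr_ge0 ?dotxx_ge0 // ltW.
have h : eta * (fgap w + lam * (fgap w - fgap w')) <=
    eta * dot (mean_grad w) (z - wstar).
  by apply: ler_wpM2l => //; rewrite gE; lra.
have c' : 2 / mu * (eta * mu * lam) * fgap w' <= 2 / mu * c * fgap w'.
  by apply: ler_wpM2r => //; apply: ler_wpM2l => //; rewrite divr_ge0 ?ltW.
have e1 : 2 / mu * (eta * mu * lam) = 2 * eta * lam by field; rewrite gt_eqF.
have e2 : 2 / mu * (eta * mu * lam + eta * mu * (1 - L * eta)) =
    2 * eta * lam + 2 * eta * (1 - L * eta) by field; rewrite gt_eqF.
have s0 := sigma2_ge0.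
have n0 : 0 <= eta ^+ 2 * L * sigma2 f wstar.
  by rewrite mulr_ge0 // mulr_ge0 ?sqr_ge0 ?ltW.
rewrite e1 in c'; rewrite e2.
apply: le_trans (lerD st (lexx _)) _; lra.
Qed.

Lemma contr_energy_step (eta lam c : R) w' w z :
  0 < eta -> eta * L <= 1 / 4 -> 0 <= lam -> z - w = lam *: (w - w') ->
  19 / 40 <= eta * mu * lam <= 41 / 80 ->
  eta * mu * lam <= (1 - eta * mu) * c ->
  \sum_S batch_prob b S *
    contr_energy (eta * mu * lam + 7 / 10 * (eta * mu)) w
      (z - eta *: batch_grad f b S w) <=
  (1 - eta * mu) * contr_energy c w' z + 22 * L * eta ^+ 2 * sigma2 f wstar.
Proof.
move=> eta0 etaL lam0 zw vt lec; rewrite /contr_energy.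
under eq_bigr do rewrite -[_ - _ + _]addrA (addrAC z) (addrAC (z - _)).
rewrite sum_batch_probD.
set X := w - wstar; set eps := eta * mu in vt lec *.
have eps0 : 0 < eps by rewrite mulr_gt0.
have eps1 : eps <= 1 / 4.
  by apply: le_trans etaL; rewrite ler_pM2l // mu_le_L.
pose U := eps^-1 *: (w - w').
have wU : w - w' = eps *: U by rewrite scalerA mulfV ?gt_eqF // scale1r.
have zU : z - w = (eps * lam) *: U by rewrite zw wU scalerA mulrC.
clearbody U.
have zX : z - wstar - 3 / 10 *: X = 7 / 10 *: X + (eps * lam) *: U.
  have -> : z - wstar = X + (eps * lam) *: U.
    by rewrite -zU [RHS]addrC addrA subrK.
  by rewrite addrAC -[X in X - _]scale1r -scalerBl; congr (_ *: _ + _); field.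
have wX : w' - wstar = X - eps *: U.
  by rewrite -wU /X opprB [RHS]addrC addrA subrK.
have zX' : z - wstar - 3 / 10 *: (w' - wstar) =
    7 / 10 *: X + (eps * lam + 3 / 10 * eps) *: U.
  by rewrite wX scalerBr opprB addrCA zX scalerA addrC -addrA -scalerDl.
have st := batch_step_le eta w (z - wstar - 3 / 10 *: X).
have form := @contr_form_ge eps (eps * lam) (11 / 10 * (eta * L)) X U.
have {}form := form _ vt _; rewrite eps0 eps1 in form.
have n1 : 11 / 10 * (eta * L) <= 11 / 40 by lra.
have {}form := form isT n1.
rewrite -zX -zX' -wX in form.
have m2 := ler_wpM2l (sqr_ge0 eta) (mean_sqr_grad_le_diff w).
have dc := dot_grad_center w; rewrite -/X in dc.
have dk := dot_grad_coco w; rewrite -/X in dk.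
have dd := dot_grad_descent lam0 zw.
have gE : dot (mean_grad w) (z - wstar - 3 / 10 *: X) =
    7 / 10 * dot (mean_grad w) X + dot (mean_grad w) (z - w).
  by rewrite zX zU dotDr dotZr.
have F' := fgap_ge0 w'.
have c' : 2 / mu * (eps * lam) * fgap w' <= 2 / mu * ((1 - eps) * c) * fgap w'.
  by apply: ler_wpM2r => //; apply: ler_wpM2l => //; rewrite divr_ge0 ?ltW.
have e1 : 2 / mu * (eps * lam) = 2 * eta * lam.
  by rewrite /eps; field; rewrite gt_eqF.
have e2 : 2 / mu * (eps * lam + 7 / 10 * eps) = 2 * eta * lam + 7 / 5 * eta.
  by rewrite /eps; field; rewrite gt_eqF.
(* The total weight [7/5 eta] of [dot (mean_grad w) X] is split: [11/5 L eta^2] of it goes to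
   cocoercivity ([h2]) and cancels the [grad_diff] part of the second moment exactly ([e3]); the
   rest goes to strong convexity. *)
have h1 : 2 * eta * (7 / 10 - 11 / 10 * (eta * L)) *
    (fgap w + mu / 2 * dot X X) <=
    2 * eta * (7 / 10 - 11 / 10 * (eta * L)) * dot (mean_grad w) X.
  by apply: ler_wpM2l => //; rewrite !mulr_ge0 ?ltW //; lra.
have h2 : 11 / 5 * (L * eta ^+ 2) * (fgap w + grad_diff w / (2 * L)) <=
    11 / 5 * (L * eta ^+ 2) * dot (mean_grad w) X.
  by apply: ler_wpM2l => //; rewrite !mulr_ge0 ?exprn_ge0 ?ltW.
have e3 : 11 / 5 * (L * eta ^+ 2) * (grad_diff w / (2 * L)) =
    11 / 10 * eta ^+ 2 * grad_diff w.
  by field; rewrite gt_eqF.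
rewrite mulrDr e3 in h2.
have h3 := ler_wpM2l (ltW eta0) dd.
have e4 : eps * lam * (eps ^+ 2 * dot U U) = eta * (lam * (mu * dot (w - w') (w - w'))).
  by rewrite wU dotZl dotZr /eps; ring.
have e5 : eps * dot X X = eta * (mu * dot X X) by rewrite mulrA.
rewrite e2.
rewrite e1 in c'.
apply: le_trans (lerD st (lexx _)) _.
rewrite gE.
rewrite e4 in form.
rewrite /eps in form c' e1 e2 *; lra.
Qed.

End finite_sums.

(** * The step-size schedule *)

Section power_bounds.
Context {R : realFieldType}.
Implicit Types (x g : R) (n : nat).

Lemma expr1B_mul_le1 x n : 0 <= x <= 1 -> (1 - x) ^+ n * (1 + n%:R * x) <= 1.
Proof.
move=> /andP[x0 x1]; elim: n => [|n IH]; first by rewrite expr0 mul0r addr0 mul1r.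
apply: le_trans IH; rewrite exprSr -mulrA; apply: ler_wpM2l.
  by rewrite exprn_ge0 // subr_ge0.
have n0 : 0 <= n%:R :> R by [].
by rewrite -natr1; nra.
Qed.

Lemma expr_ge_linear g n : 0 <= g <= 1 -> 1 - n%:R * (1 - g) <= g ^+ n.
Proof.
move=> /andP[g0 g1]; elim: n => [|n IH]; first by rewrite expr0 mul0r subr0.
have gn : g ^+ n <= 1 by exact: exprn_ile1.
rewrite exprS -natr1; nra.
Qed.

End power_bounds.

Section schedule.
Context {R : realType}.
Variables (g kappa : R).
Hypothesis g_bnd : 1 / 2 <= g < 1.
Hypothesis kappa_ge1 : 1 <= kappa.
Implicit Types k : nat.

(** With [kappa = L / mu], these three are [e_k = eta_k mu], the factor [1 - 2 eta L], and
    [theta_k = e_k lam_k]; see [step_rate] and [step_lam]. *)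
Definition rate k : R := g ^+ k.+1 / (4 * kappa).
Definition plateau : R := 1 - g / 2.
Definition damping k : R := plateau * (1 - (1 - rate k) ^+ k).

Let g_ge : 1 / 2 <= g. Proof. by case/andP: g_bnd. Qed.
Let g_lt1 : g < 1. Proof. by case/andP: g_bnd. Qed.
Let g0 : 0 < g. Proof. by have := g_ge; lra. Qed.
Let g01 : 0 <= g <= 1. Proof. by rewrite !ltW. Qed.
Let kappa0 : 0 < kappa. Proof. exact: lt_le_trans ltr01 kappa_ge1. Qed.

Lemma rate_gt0 k : 0 < rate k.
Proof. by rewrite divr_gt0 ?exprn_gt0 // mulr_gt0. Qed.

Lemma rateS k : rate k.+1 = g * rate k.
Proof. by rewrite /rate exprS mulrA. Qed.

Lemma rate_kappa k : rate k * kappa = g ^+ k.+1 / 4.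
Proof. by rewrite /rate; field; rewrite gt_eqF. Qed.

Lemma rate_kappa_le k : rate k * kappa <= 1 / 4.
Proof.
have gl := g_ge; have gu := g_lt1.
rewrite rate_kappa; have : g ^+ k.+1 <= 1 by apply: exprn_ile1; lra.
lra.
Qed.

Lemma rate_le k : rate k <= 1 / 4.
Proof.
have gl := g_ge; have gu := g_lt1.
apply: le_trans (rate_kappa_le k); rewrite -[leLHS]mulr1.
by rewrite ler_pM2l // rate_gt0.
Qed.

Lemma rateS_le k : rate k.+1 <= rate k.
Proof. by rewrite rateS; have := rate_gt0 k; have := g_lt1; nra. Qed.

Lemma damping_ge0 k : 0 <= damping k.
Proof.
have gl := g_ge; have gu := g_lt1.
rewrite mulr_ge0 //; first by rewrite /plateau; lra.
have r1 := rate_le k; have r0 := rate_gt0 k.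
by rewrite subr_ge0; apply: exprn_ile1; lra.
Qed.

Lemma damping_le k : damping k <= plateau.
Proof.
have gl := g_ge; have gu := g_lt1.
rewrite /damping -[leRHS]mulr1 ler_pM2l /plateau; last lra.
have r1 := rate_le k; have r0 := rate_gt0 k.
by rewrite gerBl exprn_ge0 //; lra.
Qed.

Lemma damping_ge k :
  1 / 2 * (1 - (1 + k%:R * rate k)^-1) <= damping k.
Proof.
have gl := g_ge; have gu := g_lt1.
have r1 := rate_le k; have r0 := rate_gt0 k.
have k0 : 0 <= k%:R :> R by [].
have d0 : 0 < 1 + k%:R * rate k by nra.
have : (1 - rate k) ^+ k <= (1 + k%:R * rate k)^-1.
  by rewrite -[leRHS]mul1r ler_pdivlMr // expr1B_mul_le1 //; lra.
have : (1 - rate k) ^+ k <= 1 by apply: exprn_ile1; lra.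
rewrite /damping /plateau => h1 h2; nra.
Qed.

Let damping_prev_ge k :
  plateau * (1 - (1 - rate k.+1) ^+ k) <= damping k.
Proof.
have gl := g_ge; have gu := g_lt1.
rewrite /damping ler_pM2l /plateau; last lra.
have r1 := rate_le k; have r0 := rate_gt0 k; have rS := rateS_le k.
by apply: lerB => //; apply: lerXn2r; rewrite ?nnegrE; lra.
Qed.

(** Supplies the premise on [c] in [mono_energy_step]. As the rate decreases, the growth is at most
    [plateau * rate k], and [plateau = 1 - g / 2] is below [1 - g ^+ k.+1 / 4]. *)
Lemma dampingS_le k :
  damping k.+1 <= damping k + rate k * (1 - g ^+ k.+1 / 4).
Proof.
have gl := g_ge; have gu := g_lt1.
apply: le_trans (lerD (damping_prev_ge k) (lexx _)).
have r1 := rate_le k.+1; have r0 := rate_gt0 k.+1; have rS := rateS_le k.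
have P0 : 0 <= (1 - rate k.+1) ^+ k by apply: exprn_ge0; lra.
have P1 : (1 - rate k.+1) ^+ k <= 1 by apply: exprn_ile1; lra.
have gk : g ^+ k.+1 <= g.
  by rewrite exprS; apply: ler_piMr; [lra|apply: exprn_ile1; lra].
have q0 : 0 <= plateau by rewrite /plateau; lra.
have : plateau * (rate k.+1 * (1 - rate k.+1) ^+ k) <= plateau * rate k.+1.
  by apply: ler_wpM2l => //; rewrite ler_piMr // ltW.
have : plateau * rate k.+1 <= (1 - g ^+ k.+1 / 4) * rate k.
  by apply: ler_pM => //; [exact: ltW|rewrite /plateau; lra].
rewrite /damping [(1 - _) ^+ _.+1]exprS; lra.
Qed.

Definition settled k : bool :=
  (160 * kappa <= k%:R) && (40 * (1 - g) <= rate k).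

Lemma settled_plateau k : settled k -> plateau <= 41 / 80.
Proof.
have gl := g_ge; have gu := g_lt1.
by move=> /andP[_]; have := rate_le k; rewrite /plateau; lra.
Qed.

Lemma settled_damping k : settled k -> 19 / 40 <= damping k <= 41 / 80.
Proof.
have gl := g_ge; have gu := g_lt1.
move=> s; rewrite (le_trans (damping_le k) (settled_plateau s)) andbT.
case/andP: s => k1 k2.
apply: le_trans (damping_ge k).
have r1 := rate_le k; have r0 := rate_gt0 k.
(* Either [k (1 - g) >= 1/2] and the second clause of [settled] gives 20, or [g ^+ k.+1] is still at
   least [49/100] and the first clause gives [40 * 49/100]. The value 19 yields
   [1/2 (1 - 1/20) = 19/40]. *)
have kr : 19 <= k%:R * rate k.
  have [h|h] := leP (1 / 2) (k%:R * (1 - g)).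
    have : k%:R * (40 * (1 - g)) <= k%:R * rate k by apply: ler_wpM2l.
    lra.
  have := @expr_ge_linear R g k.+1 g01; rewrite -natr1 => gk.
  have gk' : 49 / 100 <= g ^+ k.+1 by lra.
  have : 160 * kappa * rate k <= k%:R * rate k by apply: ler_wpM2r => //; exact: ltW.
  have := rate_kappa k; lra.
have : (1 + k%:R * rate k)^-1 <= 20^-1 by rewrite lef_pV2 ?posrE //; lra.
lra.
Qed.

(** The margin is [plateau <= 41/80] against [3/4 * 7/10 = 42/80], the least value of
    [(1 - rate k.+1) * 7/10]. *)
Lemma settled_dampingS k : settled k.+1 ->
  damping k.+1 <= (1 - rate k.+1) * (damping k + 7 / 10 * rate k).
Proof.
have gl := g_ge; have gu := g_lt1.
move=> s; have q1 := settled_plateau s.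
have r1 := rate_le k.+1; have r0 := rate_gt0 k.+1; have rS := rateS_le k.
have : (1 - rate k.+1) * (plateau * (1 - (1 - rate k.+1) ^+ k)) <=
    (1 - rate k.+1) * damping k.
  by apply: ler_wpM2l; [lra|exact: damping_prev_ge].
rewrite /damping exprS => h.
have : 41 / 80 * rate k.+1 <= (1 - rate k.+1) * (7 / 10 * rate k) by nra.
have : plateau * rate k.+1 <= 41 / 80 * rate k.+1 by apply: ler_wpM2r => //; exact: ltW.
lra.
Qed.

Definition phase k : R := \sum_(i < k) rate i.+1.
Definition settled_phase k : R := \sum_(i < k | settled i.+1) rate i.+1.

Lemma phaseS k : phase k.+1 = phase k + rate k.+1.
Proof. by rewrite /phase big_ord_recr. Qed.

Lemma settled_phaseS k : settled_phase k.+1 =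
  settled_phase k + (if settled k.+1 then rate k.+1 else 0).
Proof. by rewrite /settled_phase big_mkcond big_ord_recr /= -big_mkcond. Qed.

Lemma phase_diff_ge0 j k : (j <= k)%N -> 0 <= phase k - phase j.
Proof.
move=> /subnK <-; elim: (k - j)%N => [|m]; first by rewrite add0n subrr.
by rewrite addSn phaseS; have := rate_gt0 (m + j).+1; lra.
Qed.

(* Each step before [160 kappa] contributes at most [1 / (4 kappa)]; once the *)
(* rate is below [40 (1 - g)], it decays geometrically with ratio [g].        *)
Let unsettled_potential k : R :=
  Num.min (k%:R / (4 * kappa)) 40 - Num.min (rate k.+1 / (1 - g)) 40.

Lemma unsettled_mass k : phase k - settled_phase k <= 80.
Proof.
have u1 : 0 < 1 - g by rewrite subr_gt0.
have k4 : 0 < 4 * kappa by rewrite mulr_gt0.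
have H : phase k - settled_phase k <= unsettled_potential k + 40.
  elim: k => [|k IH].
    rewrite /phase /settled_phase !big_ord0 subrr /unsettled_potential mulr0n mul0r.
    have : Num.min (rate 1 / (1 - g)) 40 <= 40 by rewrite ge_min lexx orbT.
    by rewrite (@min_l _ _ 0) //; lra.
  have r0 := rate_gt0 k.+1.
  have A : Num.min (k%:R / (4 * kappa)) 40 <= Num.min (k.+1%:R / (4 * kappa)) 40.
    rewrite le_min2 // ler_pM2r ?invr_gt0 // ler_nat; exact: leqnSn.
  have B : Num.min (rate k.+2 / (1 - g)) 40 <= Num.min (rate k.+1 / (1 - g)) 40.
    by rewrite le_min2 // ler_pM2r ?invr_gt0 // rateS_le.
  rewrite phaseS settled_phaseS; case: ifPn => [_|].
    by move: IH; rewrite /unsettled_potential; lra.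
  rewrite negb_and -!ltNge => /orP[early|late].
    have kE : k.+1%:R / (4 * kappa) = k%:R / (4 * kappa) + 1 / (4 * kappa).
      by rewrite -natr1 mulrDl.
    have k40 : k.+1%:R / (4 * kappa) <= 40.
      by rewrite ler_pdivrMr // mulrA ltW //; lra.
    have p0 : 0 < 1 / (4 * kappa) by rewrite divr_gt0.
    have rk : rate k.+1 <= 1 / (4 * kappa).
      by rewrite /rate ler_pM2r ?invr_gt0 // exprn_ile1 // ltW.
    move: IH; rewrite /unsettled_potential (min_l k40) (@min_l _ _ (k%:R / _)); lra.
  have k40 : rate k.+1 / (1 - g) <= 40 by rewrite ler_pdivrMr // ltW.
  have rE : rate k.+2 / (1 - g) = rate k.+1 / (1 - g) - rate k.+1.
    by rewrite rateS; field; rewrite gt_eqF.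
  move: IH; rewrite /unsettled_potential (min_l k40) (@min_l _ _ (rate k.+2 / _)); lra.
apply: le_trans H _; rewrite /unsettled_potential.
have : Num.min (k%:R / (4 * kappa)) 40 <= 40 by rewrite ge_min lexx orbT.
have : 0 <= Num.min (rate k.+1 / (1 - g)) 40.
  by rewrite le_min ler0n andbT divr_ge0 // ltW // rate_gt0.
lra.
Qed.

(** The rate decreases, so its clause in [settled] cannot be regained: the settled indices form an
    interval, entered and left at most once. *)
Let unsettled_before k : ~~ settled k -> settled k.+1 -> k%:R < 160 * kappa.
Proof.
move=> nk /andP[_ rS]; rewrite ltNge; apply: contra nk => kk.
by rewrite /settled kk (le_trans rS) // rateS_le.
Qed.

Let settled_phase_le k : settled_phase k <= phase k.
Proof.
rewrite /settled_phase big_mkcond; apply: ler_sum => i _.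
by case: ifP => // _; rewrite ltW // rate_gt0.
Qed.

(** * Unrolling two energies, one nonincreasing and one contracting *)

Section energies.
Variables v e noise : nat -> R.
Hypothesis v_ge0 : forall k, 0 <= v k.
Hypothesis noise_ge0 : forall k, 0 <= noise k.
Hypothesis vS : forall k, v k.+1 <= v k + noise k.+1.
Hypothesis eS : forall k, settled k.+1 ->
  e k.+1 <= (1 - rate k.+1) * e k + noise k.+1.
Hypothesis ve : forall k, settled k -> v k <= 5 * e k.
Hypothesis ev : forall k, settled k -> e k <= 3 * v k.

Let wnoise k : R := v 0 + \sum_(i < k) expR (settled_phase i.+1) * noise i.+1.

Let wnoiseS k :
  wnoise k.+1 = wnoise k + expR (settled_phase k.+1) * noise k.+1.
Proof. by rewrite /wnoise big_ord_recr addrA. Qed.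

Let wnoise_ge0 k : 0 <= wnoise k.
Proof.
by rewrite addr_ge0 // sumr_ge0 // => i _; rewrite mulr_ge0 ?expR_ge0.
Qed.

(* The factors 6 and 5 are paid when switching from [v] to [e] and back.      *)
Let weighted_bound k :
  expR (settled_phase k) * (if settled k then e k else v k) <=
  (if k%:R < 160 * kappa then 1 else if settled k then 6 else 30) * wnoise k.
Proof.
elim: k => [|k].
  rewrite /settled_phase big_ord0 expR0 mul1r /settled /wnoise big_ord0 addr0.
  have -> : 160 * kappa <= 0 = false by apply/negbTE; rewrite -ltNge mulr_gt0.
  by rewrite /= mulr_gt0 // mul1r.
set E := expR (settled_phase k).
have E0 : 0 < E by exact: expR_gt0.
have S0 := wnoise_ge0 k; have N0 := noise_ge0 k.+1.
have vk := vS k; have r1 := rate_le k.+1; have r0 := rate_gt0 k.+1.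
have v0 := v_ge0 k.
have early : k.+1%:R < 160 * kappa -> k%:R < 160 * kappa.
  by apply: le_lt_trans; rewrite ler_nat.
have EN0 : 0 <= E * noise k.+1 by rewrite mulr_ge0 // ltW.
have Evk : E * v k.+1 <= E * v k + E * noise k.+1.
  by rewrite -mulrDr ler_pM2l.
rewrite wnoiseS settled_phaseS; have [sS|nS] := boolP (settled k.+1).
  have -> : k.+1%:R < 160 * kappa = false.
    by apply/negbTE; rewrite -leNgt; case/andP: sS.
  rewrite expRD -/E; set e1 := expR (rate k.+1).
  have e1_le2 : e1 <= 2.
    have : e1 * expR (- rate k.+1) = 1 by rewrite -expRD subrr expR0.
    have := expR_ge1Dx (- rate k.+1); have := expR_gt0 (rate k.+1); rewrite -/e1; nra.
  have e1_0 : 0 < e1 by exact: expR_gt0.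
  have e1N0 : 0 <= E * e1 * noise k.+1 by rewrite !mulr_ge0 // ltW.
  have [sk|nk] := boolP (settled k).
    have -> : k%:R < 160 * kappa = false.
      by apply/negbTE; rewrite -leNgt; case/andP: sk.
    move=> IH; have e0 : 0 <= e k by have := ve sk; lra.
    (* The growth of the exponential weight is compensated by the contraction. *)
    have contr : e1 * (1 - rate k.+1) <= 1.
      have e1V : e1 * expR (- rate k.+1) = 1 by rewrite -expRD subrr expR0.
      by rewrite -[leRHS]e1V ler_pM2l // expR_ge1Dx.
    have h1 : E * e1 * e k.+1 <= E * e1 * ((1 - rate k.+1) * e k + noise k.+1).
      by rewrite ler_pM2l ?mulr_gt0 // eS.
    have h2 : E * e k * (e1 * (1 - rate k.+1)) <= E * e k * 1.
      by apply: ler_wpM2l => //; rewrite mulr_ge0 // ltW.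
    lra.
  have kk := unsettled_before nk sS; rewrite kk mul1r => IH.
  have h1 : E * e1 * e k.+1 <= E * e1 * (3 * (v k + noise k.+1)).
    rewrite ler_pM2l ?mulr_gt0 //; apply: le_trans (ev sS) _.
    by rewrite ler_pM2l.
  have h2 : E * v k * e1 <= E * v k * 2.
    by apply: ler_wpM2l => //; rewrite mulr_ge0 // ltW.
  lra.
rewrite addr0 -/E; have [sk|nk] := boolP (settled k).
  have kF : k%:R < 160 * kappa = false.
    by apply/negbTE; rewrite -leNgt; case/andP: sk.
  rewrite kF => IH.
  have -> : k.+1%:R < 160 * kappa = false.
    by apply: contraFF kF.
  have : E * v k <= E * (5 * e k) by rewrite ler_pM2l // ve.
  lra.
case: ifP => [kk|kF] IH; last first.
  have -> : k.+1%:R < 160 * kappa = false by apply: contraFF kF.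
  lra.
by case: ifP => _; lra.
Qed.

(** [150 = 5 * 30] comes from [ve] and the worst factor of [weighted_bound]; [expR 80] is the price
    of replacing [settled_phase] by [phase]. *)
Lemma energy_bound k : v k <= 150 * expR 80 *
  (v 0 * expR (- phase k) +
   \sum_(i < k) noise i.+1 * expR (- (phase k - phase i.+1))).
Proof.
have S0 := wnoise_ge0 k.
have E0 : 0 < expR (settled_phase k) by exact: expR_gt0.
have vb : expR (settled_phase k) * v k <= 150 * wnoise k.
  have := weighted_bound k; case: ifPn => [sk|_] h; last first.
    by apply: le_trans h _; apply: ler_wpM2r => //; case: ifP; lra.
  have := ve sk; rewrite -(ler_pM2l E0) => h'.
  have : expR (settled_phase k) * e k <= 30 * wnoise k.
    by apply: le_trans h _; apply: ler_wpM2r => //; case: ifP; lra.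
  lra.
have {}vb : v k <= 150 * (expR (- settled_phase k) * wnoise k).
  rewrite -(ler_pM2l E0); apply: le_trans vb _.
  have EV : expR (settled_phase k) * expR (- settled_phase k) = 1.
    by rewrite -expRD subrr expR0.
  by rewrite mulrCA (mulrA (expR _)) EV mul1r.
apply: le_trans vb _; rewrite -[leRHS]mulrA ler_pM2l // /wnoise !mulrDr.
apply: lerD.
  rewrite [leRHS]mulrCA -expRD mulrC ler_wpM2l // ler_expR.
  have := unsettled_mass k; lra.
rewrite !mulr_sumr; apply: ler_sum => i _.
rewrite mulrA -expRD [leRHS]mulrCA -expRD mulrC ler_wpM2l // ler_expR.
by have := unsettled_mass k; have := settled_phase_le i.+1; lra.
Qed.

End energies.

End schedule.

(** * Total contraction, total noise and final energy at the horizon *)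

Section horizon.
Context {R : realType}.
Variables (g kappa tau l : R) (T : nat).
Hypothesis g_bnd : 1 / 2 <= g < 1.
Hypothesis kappa_ge1 : 1 <= kappa.
Hypothesis T_gt0 : (0 < T)%N.
Hypothesis tau_ge0 : 0 <= tau.
Hypothesis l_gt0 : 0 < l.
Hypothesis gT : g ^+ T = tau / T%:R.
Hypothesis g_l : 1 - g <= l / T%:R.

Let T0 : 0 < T%:R :> R. Proof. by rewrite ltr0n. Qed.
Let kappa0 : 0 < kappa. Proof. exact: lt_le_trans ltr01 kappa_ge1. Qed.

Lemma phase_geometric k :
  (1 - g) * (4 * kappa * phase g kappa k) = g ^+ 2 - g ^+ k.+2.
Proof.
elim: k => [|k IH]; first by rewrite /phase big_ord0 !mulr0 subrr.
rewrite phaseS !mulrDr IH /rate [g ^+ k.+3]exprS.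
by field; rewrite gt_eqF.
Qed.

(** Multiply the geometric sum by [T]: [T (1 - g) <= l] bounds its denominator, the loss from [T g]
    to [T g^2] is at most [l], and [g ^+ T = tau / T] costs at most [tau]. *)
Lemma phase_horizon_ge :
  (g * T%:R / l - 1 - tau / l) / (4 * kappa) <= phase g kappa T.-1.
Proof.
case/andP: (g_bnd) => gl gu.
rewrite ler_pdivrMr ?mulr_gt0 // [_ * (4 * kappa)]mulrC.
set Q := 4 * kappa * _; have Q0 : 0 <= Q.
  apply: mulr_ge0; first by rewrite mulr_ge0 // ltW.
  by apply: sumr_ge0 => i _; rewrite ltW // rate_gt0.
have := phase_geometric T.-1; rewrite -/Q.
rewrite prednK // [g ^+ T.+1]exprS gT => geo.
have gQ : (1 - g) * Q <= l / T%:R * Q by apply: ler_wpM2r.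
have : g * T%:R - l - tau <= l * Q.
  have h : T%:R * (g ^+ 2 - g * (tau / T%:R)) <= l * Q.
    rewrite -geo; apply: le_trans (ler_wpM2l (ltW T0) gQ) _.
    by rewrite mulrA (mulrC T%:R) divfK // gt_eqF.
  have e : T%:R * (g ^+ 2 - g * (tau / T%:R)) = T%:R * g ^+ 2 - g * tau.
    by field; rewrite gt_eqF.
  have : T%:R * (1 - g) <= l by rewrite mulrC -ler_pdivlMr.
  have := tau_ge0; have := l_gt0; rewrite e in h; nra.
move=> h; rewrite -(ler_pM2l l_gt0); have -> : l * (g * T%:R / l - 1 - tau / l) = g * T%:R - l - tau.
  by field; rewrite gt_eqF.
by [].
Qed.

Lemma sqr_mul_expRN_le (x : R) : 0 <= x -> x ^+ 2 * expR (- x) <= 2.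
Proof.
move=> x0; have := expR_ge1Dxn 1 x0; rewrite (_ : 2`!%:R = 2 :> R) // => h.
rewrite expRN ler_pdivrMr ?expR_gt0 //; lra.
Qed.

(** The geometric sum from [i] to the horizon bounds the step factor [a] by a multiple of the
    remaining phase [x], up to [tau / T]. Thus a large step is followed by strong contraction, and
    [x^2 expR (- x) <= 2] bounds the product. *)
Lemma noise_term_le i : (i.+1 <= T.-1)%N ->
  (g ^+ i.+2) ^+ 2 * expR (- (phase g kappa T.-1 - phase g kappa i.+1)) <=
  2 * (128 * kappa ^+ 2 * l ^+ 2 + tau ^+ 2) / T%:R ^+ 2.
Proof.
move=> iT; case/andP: (g_bnd) => gl gu.
set x := _ - _; have x0 : 0 <= x by exact: phase_diff_ge0.
have geo : (1 - g) * (4 * kappa * x) = g ^+ i.+3 - g * (tau / T%:R).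
  rewrite !mulrBr (phase_geometric T.-1) (phase_geometric i.+1).
  by rewrite -gT -exprS prednK //; ring.
set a := g ^+ i.+2; have a0 : 0 <= a by rewrite exprn_ge0; lra.
have aE : g * a = (1 - g) * (4 * kappa * x) + g * (tau / T%:R).
  by rewrite geo -exprS subrK.
have kx0 : 0 <= 4 * kappa * x by rewrite !mulr_ge0 // ltW.
have a_le : a <= 2 * (l / T%:R * (4 * kappa * x)) + tau / T%:R.
  have h : (1 - g) * (4 * kappa * x) <= l / T%:R * (4 * kappa * x).
    by apply: ler_wpM2r.
  have u0 : 0 <= (1 - g) * (4 * kappa * x) by rewrite mulr_ge0 //; lra.
  rewrite -subr_ge0; nra.
have t0 : 0 <= tau / T%:R by rewrite divr_ge0 // ltW.
have a2 : a ^+ 2 <= 2 * (64 * kappa ^+ 2 * (l / T%:R) ^+ 2 * x ^+ 2 + (tau / T%:R) ^+ 2).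
  have : a ^+ 2 <= (2 * (l / T%:R * (4 * kappa * x)) + tau / T%:R) ^+ 2.
    by rewrite lerXn2r ?nnegrE // (le_trans a0).
  have := sqr_ge0 (2 * (l / T%:R * (4 * kappa * x)) - tau / T%:R).
  lra.
have ex0 : 0 < expR (- x) by exact: expR_gt0.
have ex1 : expR (- x) <= 1 by rewrite -expR0 ler_expR oppr_le0.
apply: le_trans (ler_wpM2r (ltW ex0) a2) _.
have h1 : 64 * kappa ^+ 2 * (l / T%:R) ^+ 2 * (x ^+ 2 * expR (- x)) <=
    64 * kappa ^+ 2 * (l / T%:R) ^+ 2 * 2.
  apply: ler_wpM2l; last exact: sqr_mul_expRN_le.
  by apply: mulr_ge0; rewrite ?sqr_ge0 // mulr_ge0 ?sqr_ge0.
have h2 : (tau / T%:R) ^+ 2 * expR (- x) <= (tau / T%:R) ^+ 2 * 1.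
  by apply: ler_wpM2l => //; exact: sqr_ge0.
have -> : 2 * (128 * kappa ^+ 2 * l ^+ 2 + tau ^+ 2) / T%:R ^+ 2 =
    2 * (64 * kappa ^+ 2 * (l / T%:R) ^+ 2 * 2 + (tau / T%:R) ^+ 2 * 1).
  by field; rewrite gt_eqF.
lra.
Qed.

Lemma noise_sum_le (L s : R) : 0 < L -> 0 <= s ->
  \sum_(i < T.-1) 22 * L * (g ^+ i.+2 / (4 * L)) ^+ 2 * s *
    expR (- (phase g kappa T.-1 - phase g kappa i.+1)) <=
  11 / 4 * L^-1 * (128 * kappa ^+ 2 * l ^+ 2 + tau ^+ 2) * (s / T%:R).
Proof.
move=> L0 s0; set Q := 128 * kappa ^+ 2 * l ^+ 2 + tau ^+ 2.
have Q0 : 0 <= Q by rewrite addr_ge0 ?sqr_ge0 // mulr_ge0 ?sqr_ge0 // mulr_ge0 ?sqr_ge0.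
apply: (@le_trans _ _ (\sum_(i < T.-1) 11 / 8 * L^-1 * s * (2 * Q / T%:R ^+ 2))).
  apply: ler_sum => i _.
  have -> : 22 * L * (g ^+ i.+2 / (4 * L)) ^+ 2 * s *
      expR (- (phase g kappa T.-1 - phase g kappa i.+1)) = 11 / 8 * L^-1 * s *
      ((g ^+ i.+2) ^+ 2 * expR (- (phase g kappa T.-1 - phase g kappa i.+1))).
    by field; rewrite gt_eqF.
  apply: ler_wpM2l; last exact: noise_term_le.
  by rewrite !mulr_ge0 // invr_ge0 ltW.
rewrite sumr_const card_ord -[leLHS]mulr_natl.
have -> : 11 / 4 * L^-1 * Q * (s / T%:R) =
    T%:R * (11 / 8 * L^-1 * s * (2 * Q / T%:R ^+ 2)).
  by field; rewrite !gt_eqF.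
apply: ler_wpM2r; last by rewrite ler_nat leq_pred.
by rewrite !mulr_ge0 // ?invr_ge0 ?exprn_ge0 // ltW.
Qed.

(** The last rate is [tau / (4 kappa T)], and [T - 1 >= T / 2]; hence [k * rate k >= 1 / (8 kappa)]
    in [damping_ge]. This turns the last energy into a squared distance. *)
Lemma final_damping_ge : (1 < T)%N -> 1 <= tau ->
  1 / (18 * kappa) <= damping g kappa T.-1.
Proof.
move=> T1 tau1; apply: le_trans (damping_ge g_bnd kappa_ge1 T.-1).
have TE : T.-1%:R = T%:R - 1 :> R by rewrite -[in RHS](prednK T_gt0) -natr1 addrK.
have T2 : 2 <= T%:R :> R by rewrite ler_nat.
have kr : 1 / (8 * kappa) <= T.-1%:R * rate g kappa T.-1.
  rewrite /rate prednK // gT TE.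
  have -> : (T%:R - 1) * (tau / T%:R / (4 * kappa)) =
      (T%:R - 1) * tau / (4 * T%:R * kappa) by field; rewrite !gt_eqF.
  rewrite ler_pdivlMr ?mulr_gt0 //.
  have -> : 1 / (8 * kappa) * (4 * T%:R * kappa) = T%:R / 2 by field; rewrite gt_eqF.
  nra.
set y := T.-1%:R * rate g kappa T.-1 in kr *.
have y0 : 0 < y by apply: lt_le_trans kr; rewrite divr_gt0 // mulr_gt0.
have -> : 1 / 2 * (1 - (1 + y)^-1) = y / (2 * (1 + y)) by field; rewrite gt_eqF //; lra.
rewrite ler_pdivlMr; last by rewrite mulr_gt0 //; lra.
rewrite mulrAC ler_pdivrMr ?mulr_gt0 //.
move: kr; rewrite ler_pdivrMr ?mulr_gt0 // => kr.
have := kappa_ge1; nra.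
Qed.

End horizon.

(** * Expectations over batch histories *)

Section iterated_mean.
Context {R : realType} {A : finType}.
Variable p : A -> R.
Hypothesis p_ge0 : forall a, 0 <= p a.
Hypothesis p_sum : \sum_a p a = 1.

(** The last sample is averaged innermost with the earlier ones fixed, so conditioning on the past
    is built into the recursion. *)
Fixpoint iterated_mean k (g : seq A -> R) : R :=
  if k is k'.+1 then iterated_mean k' (fun s => \sum_a p a * g (rcons s a))
  else g [::].

Lemma iterated_mean_le k g h : (forall s, size s = k -> g s <= h s) ->
  iterated_mean k g <= iterated_mean k h.
Proof.
elim: k g h => [|k IH] g h gh; first exact: gh.
apply: IH => s sk; apply: ler_sum => a _; apply: ler_wpM2l => //.
by apply: gh; rewrite size_rcons sk.
Qed.

Lemma eq_iterated_mean k g h : g =1 h -> iterated_mean k g = iterated_mean k h.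
Proof. by move=> /funext ->. Qed.

Lemma iterated_mean_affine k g (x c : R) :
  iterated_mean k (fun s => x * g s + c) = x * iterated_mean k g + c.
Proof.
elim: k g => //= k IH g; rewrite -IH; apply: eq_iterated_mean => s.
under eq_bigr do rewrite mulrDr mulrCA.
by rewrite big_split /= -mulr_sumr -mulr_suml p_sum mul1r.
Qed.

Lemma iterated_mean_sum k (I : finType) (g : I -> seq A -> R) (c : I -> R) :
  iterated_mean k (fun s => \sum_i c i * g i s) =
  \sum_i c i * iterated_mean k (g i).
Proof.
elim: k g => //= k IH g; rewrite -IH; apply: eq_iterated_mean => s.
under eq_bigr do rewrite mulr_sumr.
rewrite exchange_big /=; apply: eq_bigr => i _.
by rewrite mulr_sumr; apply: eq_bigr => a _; rewrite mulrCA.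
Qed.

Lemma iterated_mean_ge0 k g : (forall s, 0 <= g s) -> 0 <= iterated_mean k g.
Proof.
elim: k g => [|k IH] g g0 /=; first exact: g0.
by apply: IH => s; apply: sumr_ge0 => a _; rewrite mulr_ge0.
Qed.

End iterated_mean.

Section history.
Context {Omega A : Type}.
Variable X : nat -> Omega -> A.

Definition history (k : nat) (o : Omega) : seq A := [seq X i o | i <- iota 0 k].

Lemma historyS k o : history k.+1 o = rcons (history k o) (X k o).
Proof. by rewrite /history -addn1 iotaD map_cat cats1. Qed.

End history.

(** * From independence to the law of the batch history *)

Section history_law.
Context {R : realType} {disp : measure_display} {Omega : measurableType disp}.
Variables (P : probability Omega R) (A : finType) (X : nat -> Omega -> A).
Variable p : A -> R.
Hypothesis p_ge0 : forall a, 0 <= p a.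
Hypothesis mX : forall k a, measurable (X k @^-1` [set a]).
Hypothesis pX : forall k a, P (X k @^-1` [set a]) = (p a)%:E.
Hypothesis iX : independent_family P X.

Let future k (t : seq A) : set Omega :=
  [set o | [seq X i o | i <- iota k (size t)] = t].

Let future_cons k a t :
  future k (a :: t) = (X k @^-1` [set a]) `&` future k.+1 t.
Proof.
by apply/seteqP; split=> o; rewrite /future /= => -[-> E]; rewrite ?E.
Qed.

Let measurable_future k t : measurable (future k t).
Proof.
elim: t k => [|a t IH] k; last by rewrite future_cons; exact: measurableI.
by rewrite (_ : future k [::] = setT) //; apply/seteqP; split.
Qed.

Let slot k (t : seq A) i : set A := [set a | onth t (i - k) = Some a].

Let slot_cons k a t i : (k < i)%N -> slot k (a :: t) i = slot k.+1 t i.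
Proof. by move=> ki; rewrite /slot -(prednK (n := i - k)) ?subn_gt0 // -subnS. Qed.

Let slot0 k a t : slot k (a :: t) k = [set a].
Proof. by apply/seteqP; split=> c; rewrite /slot /= subnn /=; [case|move=> ->]. Qed.

(** Puts a cylinder event in the shape to which the product rule of [independent_family] applies. *)
Let futureE k t :
  future k t = \bigcap_(i in [set` iota k (size t)]) (X i @^-1` slot k t i).
Proof.
elim: t k => [|a t IH] k; first by apply/seteqP; split.
rewrite future_cons IH; apply/seteqP; split=> o /=.
  move=> [ko h] i /=; rewrite inE => /predU1P[->|ki]; first by rewrite slot0.
  by rewrite slot_cons; [exact: h|move: ki; rewrite mem_iota => /andP[]].
move=> h; split=> [|i /= ki].
  by have := h k; rewrite slot0; apply; rewrite /= mem_head.
rewrite -(slot_cons a); last by move: ki; rewrite mem_iota => /andP[].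
by apply: h; rewrite /= inE ki orbT.
Qed.

Let prob_future k t : P (future k t) = (\prod_(a <- t) p a)%:E.
Proof.
rewrite futureE iX ?iota_uniq //; elim: t k => [|a t IH] k.
  by rewrite !big_nil.
rewrite /= !big_cons slot0 pX EFinM -(IH k.+1); congr (_ * _)%E.
apply: eq_big_seq => i; rewrite mem_iota => /andP[ki _].
by rewrite slot_cons.
Qed.

(* Weighting by the indicator of a prescribed future lets the induction on    *)
(* [k] move the last sample of the history into the future, so that           *)
(* independence is only needed for [k = 0].                                   *)
Let weighted_history (g : seq A -> R) k t (o : Omega) : \bar R :=
  (g (history X k o) * \1_(future k t) o)%:E.

Let weighted_historyS g k t o : weighted_history g k.+1 t o =
  (\sum_a weighted_history (fun s => g (rcons s a)) k (a :: t) o)%E.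
Proof.
rewrite /weighted_history sumEFin; congr EFin.
rewrite (bigD1 (X k o)) //= big1 ?addr0 => [|a aX].
  rewrite historyS !indicE future_cons in_setI.
  by rewrite (_ : o \in X k @^-1` [set X k o]) //; exact/mem_set.
rewrite indicE future_cons in_setI memNset ?mulr0 // => /= E.
by rewrite E eqxx in aX.
Qed.

Let measurable_weighted_history g k t :
  measurable_fun setT (weighted_history g k t).
Proof.
elim: k g t => [|k IH] g t.
  apply/measurable_EFinP; apply: measurable_funM => //.
  exact: (@measurable_cst _ _ _ _ setT (g [::])).
rewrite (_ : weighted_history g k.+1 t =
  fun o => (\sum_a weighted_history (fun s => g (rcons s a)) k (a :: t) o)%E).
  exact: emeasurable_sum.
by apply/funext => o; exact: weighted_historyS.
Qed.

Let integral_weighted_history g k t : (forall s, 0 <= g s) ->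
  (\int[P]_o weighted_history g k t o)%E =
  (iterated_mean p k g * \prod_(a <- t) p a)%:E.
Proof.
elim: k g t => [|k IH] g t g0.
  rewrite /weighted_history /history /=.
  under eq_integral do rewrite EFinM.
  rewrite ge0_integralZl //=; last 2 first.
  - exact/measurable_EFinP/measurable_indic.
  - by rewrite lee_fin.
  by rewrite integral_indic // setIT EFinM; congr (_ * _)%E; exact: prob_future.
under eq_integral do rewrite weighted_historyS.
rewrite ge0_integral_sum //; last first.
  by move=> a o _; rewrite lee_fin mulr_ge0.
transitivity (\sum_a (iterated_mean p k (fun s => g (rcons s a)) *
    \prod_(c <- a :: t) p c)%:E)%E; first by apply: eq_bigr => a _; exact: IH.
rewrite sumEFin; congr EFin => /=.
under eq_bigr do rewrite big_cons mulrA.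
rewrite -mulr_suml; congr (_ * _).
under eq_bigr do rewrite mulrC.
by rewrite -iterated_mean_sum.
Qed.

Lemma expectation_history g k : (forall s, 0 <= g s) ->
  ('E_P[fun o => g (history X k o)] = (iterated_mean p k g)%:E)%E.
Proof.
move=> g0; have := integral_weighted_history k [::] g0.
rewrite big_nil mulr1 => <-; rewrite unlock.
apply: eq_integral => o _; rewrite /weighted_history.
by rewrite indicE mem_set ?mulr1.
Qed.

End history_law.

(** * Stochastic heavy ball *)

Section gam_bounds.
Context {R : realType}.
Variables (tau : R) (T : nat).
Hypothesis tau_ge1 : 1 <= tau.
Hypothesis tau_ltT : tau < T%:R.

Let T0 : 0 < T%:R :> R. Proof. by rewrite (lt_trans _ tau_ltT) // (lt_le_trans ltr01). Qed.
Let tau0 : 0 < tau. Proof. exact: lt_le_trans ltr01 tau_ge1. Qed.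
Let x0 : 0 < tau / T%:R. Proof. by rewrite divr_gt0. Qed.

Lemma gam_gt0 : 0 < gam tau T.
Proof. exact: powR_gt0. Qed.

Lemma gam_exp : gam tau T ^+ T = tau / T%:R.
Proof.
rewrite -powR_mulrn ?ltW ?gam_gt0 // /gam -powRrM mulVf ?gt_eqF //.
by rewrite powRr1 // ltW.
Qed.

Lemma gam_bounds : 1 / 2 <= gam tau T < 1.
Proof.
have g0 := gam_gt0.
apply/andP; split.
  rewrite leNgt; apply/negP => g2.
  have : gam tau T ^+ T <= (1 / 2) ^+ T.
    by apply: lerXn2r; rewrite ?nnegrE ?ltW // divr_gt0.
  (* If [gam < 1/2], then [tau <= T / 2 ^ T < 1]. *)
  rewrite gam_exp ler_pdivrMr // => h.
  have : (1 / 2) ^+ T * T%:R < 1 :> R.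
    rewrite div1r exprVn mulrC ltr_pdivrMr ?exprn_gt0 // mul1r.
    by rewrite -natrX ltr_nat ltn_expl.
  by have := tau_ge1; lra.
rewrite ltNge; apply/negP => g1.
have : 1 <= gam tau T ^+ T by rewrite exprn_ege1.
by rewrite gam_exp ler_pdivlMr // mul1r leNgt tau_ltT.
Qed.

Lemma gam_ln : 1 - gam tau T <= ln (T%:R / tau) / T%:R.
Proof.
have g0 := gam_gt0.
have : ln (gam tau T) <= gam tau T - 1.
  have := @le_ln1Dx R (gam tau T - 1); rewrite (addrC 1) subrK; apply.
  by rewrite ltrBrDr addrC subrr.
have -> : ln (gam tau T) = - (ln (T%:R / tau) / T%:R).
  rewrite /gam ln_powR -(invf_div T%:R) lnV ?posrE ?divr_gt0 //.
  by rewrite mulrN mulrC.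
lra.
Qed.

End gam_bounds.

(** * The recursion as a function of the batches, and its energies *)

Section heavy_ball.
Context {R : realType} {d n b : nat}.
Variables (f : 'I_n -> 'rV[R]_d -> R) (L mu tau : R) (wstar w0 : 'rV[R]_d).
Variable T : nat.
Hypothesis d_gt0 : (0 < d)%N.
Hypothesis b1n : (1 <= b <= n)%N.
Hypothesis L_gt0 : 0 < L.
Hypothesis mu_gt0 : 0 < mu.
Hypothesis cf : forall i, convex (f i).
Hypothesis sf : forall i, smooth L (f i).
Hypothesis bf : forall i, has_lbound (range (f i)).
Hypothesis scf : strongly_convex mu (favg f).
Hypothesis wmin : forall x, favg f wstar <= favg f x.
Hypothesis tau_ge1 : 1 <= tau.
Hypothesis tau_ltT : tau < T%:R.

Let kappa := L / mu.
Let g := gam tau T.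
Let s2 := sigma2 f wstar.

Let g_bnd : 1 / 2 <= g < 1. Proof. exact: gam_bounds. Qed.
Let kappa_ge1 : 1 <= kappa.
Proof. by rewrite ler_pdivlMr // mul1r (mu_le_L d_gt0 b1n L_gt0 cf sf scf wmin). Qed.
Let s2_ge0 : 0 <= s2. Proof. exact: sigma2_ge0 b1n L_gt0 sf bf. Qed.

(** The state carries the iteration counter because steps and weights depend on it; folding from the
    left makes [rcons] one further iteration. *)
Definition shb_next (st : nat * ('rV[R]_d * 'rV[R]_d)) (S : {set 'I_n}) :=
  let k := st.1.+1 in
  let w := (lam L mu tau T k / (lam L mu tau T k + 1)) *: st.2.1 +
           (lam L mu tau T k + 1)^-1 *: st.2.2 in
  (k, (w, st.2.2 - step L tau T k *: batch_grad f b S w)).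

Definition shb (s : seq {set 'I_n}) := foldl shb_next (0%N, (w0, w0)) s.

Lemma shb_size s : (shb s).1 = size s.
Proof.
by elim/last_ind: s => // s S IH; rewrite /shb foldl_rcons size_rcons -IH.
Qed.

Let stepE k : step L tau T k = g ^+ k.+1 / (4 * L).
Proof. by rewrite /step mulrC. Qed.

Let step_gt0 k : 0 < step L tau T k.
Proof. by rewrite stepE divr_gt0 ?exprn_gt0 ?gam_gt0 // mulr_gt0. Qed.

Let step_rate k : step L tau T k * mu = rate g kappa k.
Proof. by rewrite stepE /rate /kappa; field; rewrite !gt_eqF. Qed.

Let step_L k : L * step L tau T k = g ^+ k.+1 / 4.
Proof. by rewrite stepE; field; rewrite gt_eqF. Qed.

Let step_lam k : step L tau T k * mu * lam L mu tau T k = damping g kappa k.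
Proof.
have e : 2 * step L tau T 0 * L = g / 2.
  by rewrite -mulrA (mulrC _ L) step_L expr1; field.
rewrite /lam e step_rate /damping /plateau.
have r0 : 0 < rate g kappa k by exact: rate_gt0.
by field; rewrite gt_eqF.
Qed.

Let lam_ge0 k : 0 <= lam L mu tau T k.
Proof.
have r0 : 0 < rate g kappa k by exact: rate_gt0.
by rewrite -(pmulr_rge0 _ r0) -step_rate step_lam damping_ge0.
Qed.

Let V k s := mono_energy f mu wstar
  (damping g kappa k + rate g kappa k * (1 - g ^+ k.+1 / 4)) (shb s).2.1 (shb s).2.2.

Let E k s := contr_energy f mu wstar
  (damping g kappa k + 7 / 10 * rate g kappa k) (shb s).2.1 (shb s).2.2.

Let noise k : R := 22 * L * (g ^+ k.+1 / (4 * L)) ^+ 2 * s2.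

(** The averaging recursion solved for [z - w], as both one-step lemmas require. *)
Let momentum k (w z : 'rV[R]_d) : let lk := lam L mu tau T k in
  z - ((lk / (lk + 1)) *: w + (lk + 1)^-1 *: z) =
  lk *: ((lk / (lk + 1)) *: w + (lk + 1)^-1 *: z - w).
Proof.
move=> lk; have l0 : 0 <= lk := lam_ge0 k.
apply/rowP => j; rewrite !mxE; field; rewrite gt_eqF //; lra.
Qed.

Let V_step k s : size s = k ->
  \sum_S batch_prob b S * V k.+1 (rcons s S) <= V k s + noise k.+1.
Proof.
move=> sk; rewrite /V /noise -stepE /s2 -step_lam -step_rate -step_L.
under eq_bigr => S _ do rewrite /shb foldl_rcons -/(shb s) /= shb_size sk.
apply: (mono_energy_step b1n) => //; first exact: ltW.
by rewrite step_lam; exact: dampingS_le.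
Qed.

Let E_step k s : size s = k -> settled g kappa k.+1 ->
  \sum_S batch_prob b S * E k.+1 (rcons s S) <=
  (1 - rate g kappa k.+1) * E k s + noise k.+1.
Proof.
move=> sk st; rewrite /E /noise -stepE /s2 -step_lam -step_rate.
under eq_bigr => S _ do rewrite /shb foldl_rcons -/(shb s) /= shb_size sk.
apply: (contr_energy_step d_gt0 b1n) => //.
- case/andP: g_bnd => gl gu; rewrite mulrC step_L.
  have : g ^+ k.+2 <= 1 by apply: exprn_ile1; lra.
  lra.
- by rewrite step_lam; exact: settled_damping.
by rewrite step_lam step_rate; exact: settled_dampingS.
Qed.

Let gap_sqr w : dot (w - wstar) (w - wstar) <= 2 / mu * fgap f wstar w.
Proof.
have := fgap_ge b1n L_gt0 cf sf scf wmin w.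
rewrite -[leLHS](mulfK (x := mu)) ?gt_eqF // => h.
rewrite -(ler_pM2l mu_gt0).
have -> : mu * (2 / mu * fgap f wstar w) = 2 * fgap f wstar w.
  by field; rewrite gt_eqF.
move: h; rewrite mulfK ?gt_eqF //; lra.
Qed.

Let potential_ge k : damping g kappa k <=
  damping g kappa k + rate g kappa k * (1 - g ^+ k.+1 / 4).
Proof.
case/andP: g_bnd => gl gu.
have r0 : 0 < rate g kappa k by exact: rate_gt0.
have : g ^+ k.+1 <= 1 by apply: exprn_ile1; lra.
by move=> h; rewrite lerDl mulr_ge0 ?ltW //; lra.
Qed.

Let V_ge k s : damping g kappa k * dot ((shb s).2.1 - wstar) ((shb s).2.1 - wstar)
  <= V k s.
Proof.
rewrite /V /mono_energy; set w := (shb s).2.1; set z := (shb s).2.2.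
have z0 := dotxx_ge0 (z - wstar).
have d0 : 0 <= damping g kappa k by exact: damping_ge0.
have h1 := ler_wpM2l d0 (gap_sqr w).
have h2 : damping g kappa k * (2 / mu * fgap f wstar w) <=
    (damping g kappa k + rate g kappa k * (1 - g ^+ k.+1 / 4)) *
    (2 / mu * fgap f wstar w).
  by apply: ler_wpM2r (potential_ge k); apply: le_trans (gap_sqr w); exact: dotxx_ge0.
lra.
Qed.

Let V_ge0 k s : 0 <= V k s.
Proof.
apply: le_trans (V_ge k s); rewrite mulr_ge0 ?dotxx_ge0 //; exact: damping_ge0.
Qed.

Let V_le_E k s : settled g kappa k -> V k s <= 5 * E k s.
Proof.
move=> st; rewrite /V /E /mono_energy /contr_energy.
set w := (shb s).2.1; set z := (shb s).2.2.
have /andP[d1 d2] : 19 / 40 <= damping g kappa k <= 41 / 80 by exact: settled_damping.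
have r0 : 0 < rate g kappa k by exact: rate_gt0.
have gk : 0 <= g ^+ k.+1 by rewrite exprn_ge0 // ltW // gam_gt0.
have phi := gap_sqr w; rewrite !(mulrAC (2 / mu) _ (fgap f wstar w)).
move: phi; set x := w - wstar; set p := 2 / mu * _ => phi.
clearbody x p.
have x0 := dotxx_ge0 x.
have u0 := dotxx_ge0 (z - wstar - 3 / 10 *: x).
(* In [5 E - V], [4 |y|^2 - 3 <x, y>] equals [3 |y - 3/10 x|^2 + |y - 3/5 x|^2 - 63/100 |x|^2]; the
   [|x|^2] deficit is covered by [4 theta phi >= 19/10 |x|^2]. *)
have y0 := dotxx_ge0 (z - wstar - 3 / 5 *: x).
have p0 : 0 <= p by exact: le_trans phi.
have rp : 0 <= rate g kappa k * p by rewrite mulr_ge0 // ltW.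
have rgp : 0 <= rate g kappa k * p * g ^+ k.+1 by rewrite mulr_ge0.
have dp : 19 / 40 * p <= damping g kappa k * p by exact: ler_wpM2r.
move: u0 y0; move: (z - wstar) => y.
rewrite !(dotDl, dotDr, dotNl, dotNr, dotZl, dotZr) (dotC x y); lra.
Qed.

Let E_le_V k s : settled g kappa k -> E k s <= 3 * V k s.
Proof.
move=> st; rewrite /V /E /mono_energy /contr_energy.
set w := (shb s).2.1; set z := (shb s).2.2.
have /andP[d1 d2] : 19 / 40 <= damping g kappa k <= 41 / 80 by exact: settled_damping.
have r0 : 0 < rate g kappa k by exact: rate_gt0.
case/andP: g_bnd => gl gu.
have gk : g ^+ k.+1 <= 1 by apply: exprn_ile1; lra.
have phi := gap_sqr w; rewrite !(mulrAC (2 / mu) _ (fgap f wstar w)).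
move: phi; set x := w - wstar; set p := 2 / mu * _ => phi.
clearbody x p.
have x0 := dotxx_ge0 x.
have y0 := dotxx_ge0 (z - wstar + 3 / 10 *: x).
have p0 : 0 <= p by exact: le_trans phi.
have rp : 0 <= rate g kappa k * p by rewrite mulr_ge0 // ltW.
have rgp : rate g kappa k * p * g ^+ k.+1 <= rate g kappa k * p * 1.
  by apply: ler_wpM2l.
have dp : 19 / 40 * p <= damping g kappa k * p by exact: ler_wpM2r.
have yy := dotxx_ge0 (z - wstar).
move: y0 yy; move: (z - wstar) => y.
rewrite !(dotDl, dotDr, dotNl, dotNr, dotZl, dotZr) (dotC x y); lra.
Qed.

Let V_init : V 0 [::] <= 2 * kappa * dot (w0 - wstar) (w0 - wstar).
Proof.
rewrite /V /mono_energy /= /damping expr0 subrr mulr0 add0r.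
case/andP: g_bnd => gl gu.
have r0 : 0 < rate g kappa 0 by exact: rate_gt0.
have r1 : rate g kappa 0 <= 1 / 4 by exact: rate_le.
have x0 := dotxx_ge0 (w0 - wstar).
have F0 := fgap_ge0 wmin w0.
have F1 := fgap_le b1n L_gt0 sf wmin w0.
have c1 : rate g kappa 0 * (1 - g ^+ 1 / 4) <= 1 by rewrite expr1; nra.
have kx : kappa * dot (w0 - wstar) (w0 - wstar) =
    2 / mu * (L / 2 * dot (w0 - wstar) (w0 - wstar)).
  by rewrite /kappa; field; rewrite gt_eqF.
have m0 : 0 <= 2 / mu by rewrite divr_ge0 // ltW.
have h1 := ler_wpM2l m0 F1.
have h2 : 2 / mu * fgap f wstar w0 * (rate g kappa 0 * (1 - g ^+ 1 / 4)) <=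
    2 / mu * fgap f wstar w0 * 1.
  by apply: ler_wpM2l => //; rewrite mulr_ge0.
have h3 : 1 * dot (w0 - wstar) (w0 - wstar) <= kappa * dot (w0 - wstar) (w0 - wstar).
  exact: ler_wpM2r.
lra.
Qed.

Let Em k (h : seq {set 'I_n} -> R) : R := iterated_mean (batch_prob b) k h.

Let Em_le k h h' : (forall s, size s = k -> h s <= h' s) -> Em k h <= Em k h'.
Proof. exact: (iterated_mean_le (@batch_prob_ge0 R n b)). Qed.

Let Em_affine k h x c : Em k (fun s => x * h s + c) = x * Em k h + c.
Proof. exact: (iterated_mean_affine (sum_batch_prob b1n) k h x c). Qed.

Let l := ln (T%:R / tau).

Let T_gt0 : (0 < T)%N.
Proof. by rewrite -(ltr_nat R) (lt_trans _ tau_ltT) // (lt_le_trans ltr01). Qed.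

Let T_gt1 : (1 < T)%N.
Proof. by rewrite -(ltr_nat R) (le_lt_trans _ tau_ltT). Qed.

Let l_gt0 : 0 < l.
Proof. by rewrite ln_gt0 // ltr_pdivlMr ?mul1r // (lt_le_trans ltr01). Qed.

Lemma shb_mean_sqr_dist :
  iterated_mean (batch_prob b) T.-1
    (fun s => dot ((shb s).2.1 - wstar) ((shb s).2.1 - wstar)) <=
  2700 * expR 80 * kappa *
    (2 * kappa * dot (w0 - wstar) (w0 - wstar) * expR (- phase g kappa T.-1) +
     11 / 4 * L^-1 * (128 * kappa ^+ 2 * l ^+ 2 + tau ^+ 2) * (s2 / T%:R)).
Proof.
have k0 : 0 < kappa by exact: lt_le_trans ltr01 kappa_ge1.
have tau0 : 0 <= tau by exact: le_trans ler01 tau_ge1.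
have N0 k : 0 <= noise k.
  by rewrite mulr_ge0 // mulr_ge0 ?sqr_ge0 // mulr_ge0 // ltW.
have Vm0 k : 0 <= Em k (V k).
  by apply: iterated_mean_ge0 => [|s]; [exact: batch_prob_ge0|exact: V_ge0].
have VS k : Em k.+1 (V k.+1) <= Em k (V k) + noise k.+1.
  rewrite -[Em k (V k)]mul1r -Em_affine /=.
  by apply: Em_le => s sk; rewrite mul1r; exact: V_step.
have ES k : settled g kappa k.+1 ->
    Em k.+1 (E k.+1) <= (1 - rate g kappa k.+1) * Em k (E k) + noise k.+1.
  by move=> st; rewrite -Em_affine /=; apply: Em_le => s sk; exact: E_step.
have VE k : settled g kappa k -> Em k (V k) <= 5 * Em k (E k).
  move=> st; rewrite -[leRHS]addr0 -Em_affine.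
  by apply: Em_le => s _; rewrite addr0; exact: V_le_E.
have EV k : settled g kappa k -> Em k (E k) <= 3 * Em k (V k).
  move=> st; rewrite -[leRHS]addr0 -Em_affine.
  by apply: Em_le => s _; rewrite addr0; exact: E_le_V.
have := energy_bound g_bnd kappa_ge1 Vm0 N0 VS ES VE EV T.-1.
have gT : g ^+ T = tau / T%:R by exact: gam_exp.
have gl : 1 - g <= l / T%:R by exact: gam_ln.
have := noise_sum_le g_bnd kappa_ge1 T_gt0 tau0 gT gl L_gt0 s2_ge0.
set NS := \sum_(i < _) _ => ns; rewrite -/NS => vb.
have dk := final_damping_ge g_bnd kappa_ge1 T_gt0 gT T_gt1 tau_ge1.
have fin : Em T.-1 (fun s => dot ((shb s).2.1 - wstar) ((shb s).2.1 - wstar)) <=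
    18 * kappa * Em T.-1 (V T.-1).
  rewrite -[leRHS]addr0 -Em_affine; apply: Em_le => s _; rewrite addr0.
  have := V_ge T.-1 s; set y := dot _ _.
  have y0 : 0 <= y by exact: dotxx_ge0.
  have := ler_wpM2r y0 dk => h1 h2.
  have k18 : 0 < 18 * kappa by apply: mulr_gt0.
  by have := le_trans h1 h2; rewrite mulrAC mul1r ler_pdivrMr // [V _ _ * _]mulrC.
apply: le_trans fin _.
have vb' : Em T.-1 (V T.-1) <= 150 * expR 80 *
   (2 * kappa * dot (w0 - wstar) (w0 - wstar) * expR (- phase g kappa T.-1) +
     11 / 4 * L^-1 * (128 * kappa ^+ 2 * l ^+ 2 + tau ^+ 2) * (s2 / T%:R)).
  apply: le_trans vb _; rewrite ler_pM2l ?mulr_gt0 ?expR_gt0 //.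
  by apply: lerD => //; apply: ler_wpM2r; [exact: expR_ge0|exact: V_init].
have := ler_wpM2l (ltW (mulr_gt0 (ltr0n R 18) k0)) vb'.
lra.
Qed.

End heavy_ball.

Section shb_history.
Context {R : realType} {d n b : nat} {Omega : Type}.
Variables (f : 'I_n -> 'rV[R]_d -> R) (L mu tau : R) (w0 : 'rV[R]_d) (T : nat).
Variables (B : nat -> Omega -> {set 'I_n}) (w z : nat -> Omega -> 'rV[R]_d).
Hypothesis w_0 : forall o, w 0%N o = w0.
Hypothesis z_0 : forall o, z 0%N o = w0.
Hypothesis wS : forall k o, w k.+1 o =
  (lam L mu tau T k.+1 / (lam L mu tau T k.+1 + 1)) *: w k o +
  (lam L mu tau T k.+1 + 1)^-1 *: z k o.
Hypothesis zS : forall k o, z k.+1 o =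
  z k o - step L tau T k.+1 *: batch_grad f b (B k.+1 o) (w k.+1 o).

Lemma shb_historyE k o :
  shb (b := b) f L mu tau w0 T (history (fun i => B i.+1) k o) =
  (k, (w k o, z k o)).
Proof.
elim: k => [|k IH]; first by rewrite w_0 z_0.
by rewrite historyS /shb foldl_rcons -/(shb _ _ _ _ _ _ _) IH zS wS.
Qed.

End shb_history.

(** * The constants of the final bound *)

Section constants.
Context {R : realType}.
Implicit Types (L tau zeta kappa : R) (T : nat).

(* The value of [ln (T / tau)] at the least admissible [T].                   *)
Definition min_log tau : R := ln ((Num.trunc tau).+1%:R / tau).

(** [5400 kappa^2] collects [18 kappa] ([final_damping_ge]), 150 ([energy_bound]) and [2 kappa]
    ([V_init]). The last exponential absorbs the loss [(1 + tau / l) / (4 kappa)] of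
    [phase_horizon_ge], with [min_log] making it independent of [T]. *)
Definition const4 L tau zeta kappa T : R :=
  5400 * expR 80 * expR ((1 + tau / min_log tau) / 4) * kappa ^+ 2.

(** The factor from [noise_sum_le], with [ln T >= ln (T / tau)]. The absolute value keeps it
    nonnegative for every real [L], as [poly_polylog] demands. *)
Definition const5 L tau zeta kappa T : R :=
  11 / 4 * `|L|^-1 * (128 * kappa ^+ 2 * ln T%:R ^+ 2 + tau ^+ 2).

Lemma poly_polylog_const4 : poly_polylog const4.
Proof.
exists 2%N, 0%N => L tau zeta.
exists (5400 * expR 80 * expR ((1 + tau / min_log tau) / 4)) => kappa T k1 T1 tT.
apply/andP; split; last by rewrite expr0 mulr1.
apply: mulr_ge0 (sqr_ge0 _); apply: mulr_ge0 (expR_ge0 _).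
by apply: mulr_ge0 (expR_ge0 _); exact: ler0n.
Qed.

Lemma poly_polylog_const5 : poly_polylog const5.
Proof.
exists 2%N, 2%N => L tau zeta.
exists (11 / 4 * `|L|^-1 * (128 + 4 * tau ^+ 2)) => kappa T k1 T1 tT.
(* This makes [kappa^2 (ln T)^2] at least [1/4], so it absorbs [tau^2] at the cost of the factor
   4. *)
have lnT : 1 / 2 <= ln (T%:R : R).
  have T2 : 2 <= T%:R :> R by rewrite ler_nat.
  have := @le_ln1Dx R (T%:R^-1 - 1); rewrite (addrC 1) subrK => h.
  have Ti : T%:R^-1 <= 1 / 2 :> R by rewrite div1r lef_pV2 ?posrE //; lra.
  have : ln (T%:R^-1 : R) <= T%:R^-1 - 1.
    by apply: h; rewrite ltrBrDr addrC subrr invr_gt0; lra.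
  rewrite lnV ?posrE; lra.
have c0 : 0 <= 11 / 4 * `|L|^-1 by rewrite mulr_ge0 ?invr_ge0.
have t2 := sqr_ge0 tau.
have kl0 : 0 <= kappa ^+ 2 * ln T%:R ^+ 2 by rewrite mulr_ge0 ?sqr_ge0.
apply/andP; split; first by rewrite mulr_ge0 //; lra.
rewrite -!(mulrA (11 / 4 * `|L|^-1)) ler_wpM2l //.
have kl : 1 / 4 <= kappa ^+ 2 * ln T%:R ^+ 2.
  have : 1 <= kappa ^+ 2 by rewrite exprn_ege1.
  have : 1 / 4 <= ln (T%:R : R) ^+ 2 by nra.
  nra.
nra.
Qed.

Lemma min_log_gt0 tau : 1 <= tau -> 0 < min_log tau.
Proof.
move=> t1; rewrite ln_gt0 // ltr_pdivlMr ?mul1r ?truncnS_gt //.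
exact: lt_le_trans ltr01 t1.
Qed.

Lemma min_log_le tau T : 1 <= tau -> tau < T%:R -> min_log tau <= ln (T%:R / tau).
Proof.
move=> t1 tT; have t0 : 0 < tau by exact: lt_le_trans ltr01 t1.
have T0 : 0 < T%:R :> R by exact: lt_trans t0 tT.
rewrite ler_ln ?posrE ?divr_gt0 // ler_pM2r ?invr_gt0 // ler_nat.
by rewrite truncn_lt_nat // ltW.
Qed.

End constants.

Theorem theorem1 (R : realType) :
  exists C4 C5 : R -> R -> R -> R -> nat -> R,
    poly_polylog C4 /\ poly_polylog C5 /\
    forall (d n b : nat) (f : 'I_n -> 'rV[R]_d -> R) (L mu : R)
      (wstar w0 : 'rV[R]_d) (tau : R) (T : nat)
      (disp : measure_display) (Omega : measurableType disp)
      (P : probability Omega R) (B : nat -> Omega -> {set 'I_n})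
      (w z : nat -> Omega -> 'rV[R]_d),
    (0 < d)%N -> (1 <= b <= n)%N ->
    0 < L -> 0 < mu ->
    (forall i, convex (f i)) ->
    (forall i, smooth L (f i)) ->
    (forall i, has_lbound (range (f i))) ->
    strongly_convex mu (favg f) ->
    (forall x, favg f wstar <= favg f x) ->
    1 <= tau -> tau < T%:R ->
    iid_uniform_batches P b (fun k => B k.+1) ->
    (forall o, w 0%N o = w0) ->
    (forall o, z 0%N o = w0) ->
    (forall k o, w k.+1 o =
       (lam L mu tau T k.+1 / (lam L mu tau T k.+1 + 1)) *: w k o +
       (lam L mu tau T k.+1 + 1)^-1 *: z k o) ->
    (forall k o, z k.+1 o =
       z k o - step L tau T k.+1 *: batch_grad f b (B k.+1 o) (w k.+1 o)) ->
    let kappa := L / mu in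
    let c4 := C4 L tau (zeta n b) kappa T in
    let c5 := C5 L tau (zeta n b) kappa T in
    ('E_P[fun o => (enorm (w T.-1 o - wstar) ^+ 2)%R] <=
      (c4 * enorm (w0 - wstar) ^+ 2 *
         expR (- (T%:R / kappa * (gam tau T / (4 * ln (T%:R / tau))))) +
       c4 * c5 * (sigma2 f wstar / T%:R))%:E)%E.
Proof.
exists const4, const5; split; first exact: poly_polylog_const4.
split; first exact: poly_polylog_const5.
move=> d n b f L mu wstar w0 tau T disp Omega P B w z d0 b1n L0 mu0 cf sf bf scf wmin.
move=> tau1 tauT [mB pB iB] w_0 z_0 wS zS; cbv zeta.
set kappa := L / mu; set c4 := const4 _ _ _ _ _; set c5 := const5 _ _ _ _ _.
pose gap s := dot ((shb (b := b) f L mu tau w0 T s).2.1 - wstar)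
  ((shb (b := b) f L mu tau w0 T s).2.1 - wstar).
(* Iteration [k >= 1] uses [B k] while histories start at index 0, hence the shift. *)
have -> : (fun o => (enorm (w T.-1 o - wstar) ^+ 2)%R) =
    (fun o => gap (history (fun i => B i.+1) T.-1 o)).
  by apply/funext => o; rewrite enorm_sqr /gap (shb_historyE w_0 z_0 wS zS).
rewrite (expectation_history (X := fun i => B i.+1) (p := batch_prob b) mB pB iB); last by move=> s; exact: dotxx_ge0.
rewrite lee_fin.
apply: le_trans (shb_mean_sqr_dist w0 d0 b1n L0 mu0 cf sf bf scf wmin tau1 tauT) _.
rewrite -/kappa -enorm_sqr; set l := ln (T%:R / tau); set g := gam tau T.
set x0 := enorm _ ^+ 2; set s2 := sigma2 f wstar.
have t0 : 0 < tau by exact: lt_le_trans ltr01 tau1.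
have T0 : 0 < T%:R :> R by exact: lt_trans t0 tauT.
have T1 : (1 < T)%N by rewrite -(ltr_nat R) (le_lt_trans tau1).
have l0 := min_log_gt0 tau1; have l1 := min_log_le tau1 tauT.
have lp : 0 < l by exact: lt_le_trans l1.
have k1 : 1 <= kappa.
  by rewrite ler_pdivlMr // mul1r (mu_le_L d0 b1n L0 cf sf scf wmin).
have k0 : 0 < kappa by exact: lt_le_trans ltr01 k1.
have e80 : 0 < expR 80 :> R by exact: expR_gt0.
pose X := expR ((1 + tau / min_log tau) / 4).
have X1 : 1 <= X.
  by rewrite -expR0 ler_expR divr_ge0 // addr_ge0 // divr_ge0 // ltW.
have c4E : c4 = 5400 * expR 80 * X * kappa ^+ 2 by [].
rewrite mulrDr; apply: lerD.
  have ph : expR (- phase g kappa T.-1) <=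
      X * expR (- (T%:R / kappa * (g / (4 * l)))).
    rewrite -expRD ler_expR.
    have := phase_horizon_ge (gam_bounds tau1 tauT) k1 (ltnW T1) (ltW t0) lp
      (gam_exp tau1 tauT) (gam_ln tau1 tauT).
    rewrite -/g.
    have -> : (g * T%:R / l - 1 - tau / l) / (4 * kappa) =
        T%:R / kappa * (g / (4 * l)) - (1 + tau / l) / (4 * kappa).
      by field; rewrite !gt_eqF.
    have : (1 + tau / l) / (4 * kappa) <= (1 + tau / min_log tau) / 4.
      apply: ler_pM.
      - by rewrite addr_ge0 // divr_ge0 // ltW.
      - by rewrite invr_ge0 mulr_ge0 // ltW.
      - by rewrite lerD2l ler_pM2l // lef_pV2.
      - rewrite lef_pV2 ?posrE //; last exact: mulr_gt0.
        by rewrite -[leLHS]mulr1 ler_pM2l.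
    lra.
  have x00 : 0 <= x0 by exact: sqr_ge0.
  have A0 : 0 <= 5400 * expR 80 * kappa ^+ 2 * x0.
    apply: mulr_ge0 x00; apply: mulr_ge0 (sqr_ge0 _).
    by apply: mulr_ge0 (ltW e80); exact: ler0n.
  have := ler_wpM2l A0 ph; rewrite c4E; lra.
have s0 : 0 <= s2 / T%:R.
  by rewrite divr_ge0 ?(ltW T0) // (sigma2_ge0 wstar b1n L0 sf bf).
rewrite [leLHS]mulrA; apply: ler_wpM2r => //; apply: ler_pM.
- apply: mulr_ge0 (ltW k0); apply: mulr_ge0 (ltW e80); exact: ler0n.
- by rewrite mulr_ge0 ?addr_ge0 ?mulr_ge0 ?sqr_ge0 ?invr_ge0 // ltW.
(* The noise needs only [2700 expR 80 * kappa], which [c4] dominates since [X] and [kappa] are at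
   least 1. *)
- rewrite c4E; have : kappa <= X * kappa ^+ 2.
    apply: le_trans (ler_peMl (sqr_ge0 _) X1).
    by rewrite expr2 ler_peMr // ltW.
  by move=> /(ler_wpM2l (ltW e80)); have := mulr_gt0 e80 k0; lra.
rewrite /c5 /const5 gtr0_norm //; apply: ler_wpM2l.
  by rewrite mulr_ge0 // invr_ge0 ltW.
rewrite lerD2r; apply: ler_wpM2l; first by rewrite mulr_ge0 ?sqr_ge0.
apply: lerXn2r; rewrite ?nnegrE ?(ltW lp) //.
  by rewrite ln_ge0 // (ler_nat _ 1) ltnW.
by rewrite ler_ln ?posrE ?divr_gt0 // ler_pdivrMr // ler_peMr // ltW.
Qed.
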